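(* Let $g\in H(\mathbb{D})$ and let $V_g\colon A(\mathbb{D})\to A(\mathbb{D})$ be compact. Then $H^\infty$ is a proper subspace of $[V_g,A(\mathbb{D})]=[T_g,A(\mathbb{D})]$.
   Context: $\mathbb{D}=\{z\in\mathbb{C}:|z|<1\}$; $H(\mathbb{D})$ is the Fréchet space of all analytic functions on $\mathbb{D}$ with the topology of uniform convergence on compact sets; $H^\infty$ is the space of bounded analytic functions on $\mathbb{D}$ with the sup-norm; $A(\mathbb{D})$ is the disc algebra, i.e. the closed subspace of $H^\infty$ of functions in $H(\mathbb{D})$ that extend continuously to $\overline{\mathbb{D}}$. For $g,f\in H(\mathbb{D})$, $(V_gf)(z):=\int_0^z f(\xi)g'(\xi)\,d\xi$ for $z\in\mathbb{D}$, and $(T_gf)(z):=\frac1z\int_0^z f(\xi)g'(\xi)\,d\xi$ for $z\in\mathbb{D}\setminus\{0\}$, $(T_gf)(0):=f(0)g'(0)$. For $X$ a Banach space continuously included in $H(\mathbb{D})$ and $T\colon H(\mathbb{D})\to H(\mathbb{D})$ continuous linear with $T(X)\subseteq X$, the optimal domain is $[T,X]:=\{f\in H(\mathbb{D}):Tf\in X\}$ with (semi-)norm $\|f\|_{[T,X]}:=\|Tf\|_X$. Saying that $T\colon X\to X$ is compact includes that $T(X)\subseteq X$. *)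

(* Defs.v *)
(* Functions on the unit disc are represented by total functions C -> C; the
   spaces HD, HInf, disc_algebra and the optimal domains constrain only the
   values taken on the disc. *)
From Stdlib Require Import Reals List.
From Coquelicot Require Import Coquelicot.
Open Scope R_scope.
Open Scope C_scope.

Definition disc (z : C) : Prop := (Cmod z < 1)%R.
Definition closed_disc (z : C) : Prop := (Cmod z <= 1)%R.

Definition analytic_at (f : C -> C) (z : C) : Prop :=
  exists (a : nat -> C) (r : posreal), forall w : C,
    (Cmod (w - z) < r)%R ->
    @is_pseries C_AbsRing C_NormedModule a (w - z) (f w).

Definition HD (f : C -> C) : Prop := forall z : C, disc z -> analytic_at f z.

Definition HInf (f : C -> C) : Prop :=
  HD f /\ exists M : R, forall z : C, disc z -> (Cmod (f z) <= M)%R.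

Definition continuous_on (D : C -> Prop) (F : C -> C) : Prop :=
  forall z : C, D z -> filterlim F (within D (locally z)) (locally (F z)).

Definition disc_algebra (f : C -> C) : Prop :=
  HD f /\
  exists F : C -> C,
    continuous_on closed_disc F /\ forall z : C, disc z -> F z = f z.

Definition segment_integral (h : C -> C) (z1 z2 : C) : C :=
  RInt (V := C_R_CompleteNormedModule)
    (fun t : R => h (z1 + RtoC t * (z2 - z1)) * (z2 - z1)) 0%R 1%R.

(* For f and g analytic on the disc the integral does not depend on the path
   from 0 to z; the straight segment is used. *)
Definition Vop (g f : C -> C) (z : C) : C :=
  segment_integral (fun xi : C => f xi * C_derive g xi) 0 z.

Definition Top (g f : C -> C) (z : C) : C :=
  if Ceq_dec z 0 then f 0 * C_derive g 0 else / z * Vop g f z.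

Definition compact_set {T : UniformSpace} (K : T -> Prop) : Prop :=
  forall (I : Type) (U : I -> T -> Prop),
    (forall i : I, open (U i)) ->
    (forall x : T, K x -> exists i : I, U i x) ->
    exists l : list I, forall x : T, K x -> exists i : I, In i l /\ U i x.

Definition closure_of {T : UniformSpace} (E : T -> Prop) (x : T) : Prop :=
  forall eps : posreal, exists y : T, E y /\ ball x eps y.

(* The uniformity of [disc_functions] is that of uniform convergence on the
   disc, i.e. of the sup-norm. *)
Definition disc_functions : UniformSpace :=
  fct_UniformSpace {z : C | disc z} C_UniformSpace.

Definition restrict (f : C -> C) : disc_functions :=
  fun z : {z : C | disc z} => f (proj1_sig z).

Definition restrictions (X : (C -> C) -> Prop) (u : disc_functions) : Prop :=
  exists f : C -> C, X f /\ u = restrict f.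

(* For a space X of functions on the disc normed by the sup-norm: T maps X into
   X, and the closure, taken in X, of the image of the closed unit ball of X is
   compact. *)
Definition compact_operator (X : (C -> C) -> Prop) (T : (C -> C) -> C -> C)
    : Prop :=
  (forall f : C -> C, X f -> X (T f)) /\
  compact_set (fun u : disc_functions =>
    restrictions X u /\
    closure_of
      (fun v : disc_functions =>
         exists f : C -> C,
           X f /\ (forall z : C, disc z -> (Cmod (f z) <= 1)%R) /\
           v = restrict (T f))
      u).

Definition optimal_domain (T : (C -> C) -> C -> C) (X : (C -> C) -> Prop)
    (f : C -> C) : Prop :=
  HD f /\ X (T f).

Definition linear_subspace (X : (C -> C) -> Prop) : Prop :=
  X (fun _ : C => 0) /\
  (forall f h : C -> C, X f -> X h -> X (fun z => f z + h z)) /\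
  (forall (c : C) (f : C -> C), X f -> X (fun z => c * f z)).

Definition proper_subspace (X Y : (C -> C) -> Prop) : Prop :=
  linear_subspace X /\ linear_subspace Y /\
  (forall f : C -> C, X f -> Y f) /\
  (exists f : C -> C, Y f /\ ~ X f).

(* Main.v *)
(** If [V_g] is compact on the disc algebra then a bounded sequence in it whose
    images converge pointwise on the disc has a subsequence whose images converge
    uniformly. Applied to the dilations [f(r_n z)] of a bounded [f], this puts
    [V_g f] in the disc algebra. Applied to the monomials, it gives [n_k >= k]
    with [|V_g z^(n_k)| <= 2^(-k)] on the disc; then [F = sum_k z^(n_k)] is
    analytic and unbounded, while the series of the [V_g z^(n_k)] converges
    uniformly to [V_g F]. Finally [V_g f = z T_g f], and division by [z] stays in
    the disc algebra because [T_g f] is continuous at [0].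

    Analyticity of uniform limits and of quotients comes from Cauchy's formula for
    functions with a continuous complex derivative. *)
Require Import Defs.
From Stdlib Require Import Reals Lra Lia List Classical ClassicalEpsilon.
From Coquelicot Require Import Coquelicot.
(* Imported again because Stdlib's [Rtopology.disc] would shadow [Defs.disc]. *)
Require Import Defs.
Open Scope R_scope.

(** A bounded [f] need not lie in the disc algebra, so compactness says nothing about it directly.
    Its dilations do lie there but approach [f] only locally uniformly. This suffices because
    [Vop g f z] depends on the segment from 0 to [z] alone: the images converge at each point. Since
    [C_derive g] may be unbounded near the circle, that convergence is not uniform by itself; making
    it uniform is the role of compactness. For the monomials the pointwise limit of the images is 0,
    which leaves 0 as their only cluster point.

    Power series are an awkward form for quotients and uniform limits. Analyticity at a point is
    therefore shown equivalent to [C1_at], differentiability near the point with a continuous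
    derivative. The continuity allows differentiation under the integral sign while the circle of
    Cauchy's formula is contracted to a point. *)

Lemma Cmod_le_Rabs (z : C) : Cmod z <= Rabs (fst z) + Rabs (snd z).
Proof.
  destruct z as [x y]; simpl.
  replace (x, y) with (RtoC x + Ci * RtoC y)%C
    by (apply injective_projections; simpl; ring).
  eapply Rle_trans; [apply Cmod_triangle|].
  rewrite Cmod_mult, Cmod_Ci, !Cmod_R; lra.
Qed.

Lemma fst_le_Cmod (z : C) : Rabs (fst z) <= Cmod z.
Proof. eapply Rle_trans; [apply Rmax_l | apply Rmax_Cmod]. Qed.

Lemma snd_le_Cmod (z : C) : Rabs (snd z) <= Cmod z.
Proof. eapply Rle_trans; [apply Rmax_r | apply Rmax_Cmod]. Qed.

Lemma Cmod_minus_sym (z w : C) : Cmod (z - w) = Cmod (w - z).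
Proof. rewrite <- Cmod_opp; f_equal; ring. Qed.

Lemma Cmod_triangle_minus (x y z : C) : Cmod (x - z) <= Cmod (x - y) + Cmod (y - z).
Proof.
  replace (x - z)%C with ((x - y) + (y - z))%C by ring. apply Cmod_triangle.
Qed.

Lemma Cmod_minus_le (x y : C) : Cmod x - Cmod y <= Cmod (x - y).
Proof.
  pose proof (Cmod_triangle (x - y) y) as H.
  replace (x - y + y)%C with x in H by ring. lra.
Qed.

Lemma eq_of_Cmod_le (x y : C) : (forall eps, 0 < eps -> Cmod (x - y) <= eps) -> x = y.
Proof.
  intros H. replace x with (x - y + y)%C by ring.
  rewrite (Cmod_eq_0 (x - y)); [ring|].
  apply Rle_antisym; [|apply Cmod_ge_0].
  apply le_epsilon; intros e he; rewrite Rplus_0_l; auto.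
Qed.

(** * The topology of [C] and continuity, expressed by the modulus *)

Lemma ball_C_Cmod (z w : C) (e : posreal) :
  Cmod (w - z) < e -> @ball C_UniformSpace z e w.
Proof. apply C_NormedModule_mixin_compat1. Qed.

(** The balls of [C_UniformSpace] are squares, those of the product [R * R]; the factor 2 is a crude
    substitute for the square root of 2. *)
Lemma Cmod_ball_C (z w : C) (e : R) :
  @ball C_UniformSpace z e w -> Cmod (w - z) < 2 * e.
Proof.
  intros [H1 H2].
  eapply Rle_lt_trans; [apply Cmod_le_Rabs|].
  assert (Rabs (fst w - fst z) < e) by exact H1.
  assert (Rabs (snd w - snd z) < e) by exact H2.
  simpl in *. unfold Rminus in *. lra.
Qed.

Lemma locally_Cmod (z : C) (P : C -> Prop) :
  @locally C_UniformSpace z P <->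
  exists d, 0 < d /\ forall w, Cmod (w - z) < d -> P w.
Proof.
  split.
  - intros [d Hd]. exists d; split; [apply cond_pos|].
    intros w Hw; apply Hd, ball_C_Cmod, Hw.
  - intros [d [hd Hd]].
    assert (h2 : 0 < d / 2) by lra.
    exists (mkposreal _ h2). intros w Hw; apply Hd.
    apply Cmod_ball_C in Hw; simpl in Hw; lra.
Qed.

Lemma locally_Cmod_lt (w z : C) r :
  Cmod (w - z) < r -> @locally C_UniformSpace w (fun x => Cmod (x - z) < r).
Proof.
  intros h. apply locally_Cmod. exists (r - Cmod (w - z)). split; [lra|].
  intros x hx. pose proof (Cmod_triangle_minus x w z). lra.
Qed.

Lemma filterlim_Cmod {T : Type} (F : (T -> Prop) -> Prop) {FF : Filter F}
    (f : T -> C) (l : C) :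
  filterlim f F (@locally C_UniformSpace l) <->
  forall eps, 0 < eps -> F (fun y => Cmod (f y - l) < eps).
Proof.
  split.
  - intros H eps he. apply (H (fun w => Cmod (w - l) < eps)).
    apply locally_Cmod; eauto.
  - intros H P HP. apply locally_Cmod in HP. destruct HP as [d [hd Hd]].
    unfold filtermap. generalize (H d hd). apply filter_imp; auto.
Qed.

Lemma continuous_Cmod {U : UniformSpace} (f : U -> C) (x : U) :
  @continuous U C_UniformSpace f x <->
  forall eps, 0 < eps -> locally x (fun y => Cmod (f y - f x) < eps).
Proof. apply (@filterlim_Cmod U (locally x)), locally_filter. Qed.

Lemma continuous_C {U : UniformSpace} (f : U -> C) (x : U) :
  @continuous U R_UniformSpace (fun y => fst (f y)) x ->
  @continuous U R_UniformSpace (fun y => snd (f y)) x ->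
  @continuous U C_UniformSpace f x.
Proof.
  intros H1 H2. apply continuous_Cmod. intros e he.
  assert (h2 : 0 < e / 2) by lra.
  generalize (filter_and _ _
    (proj1 (filterlim_locally _ _) H1 (mkposreal _ h2))
    (proj1 (filterlim_locally _ _) H2 (mkposreal _ h2))).
  apply filter_imp. intros y [Ha Hb].
  eapply Rle_lt_trans; [apply Cmod_le_Rabs|].
  assert (Rabs (fst (f y) - fst (f x)) < e / 2) by exact Ha.
  assert (Rabs (snd (f y) - snd (f x)) < e / 2) by exact Hb.
  simpl in *. unfold Rminus in *. lra.
Qed.

Lemma continuous_fst_C {U : UniformSpace} (f : U -> C) (x : U) :
  @continuous U C_UniformSpace f x ->
  @continuous U R_UniformSpace (fun y => fst (f y)) x.
Proof.
  intros H. apply (continuous_comp f (fun z : R * R => fst z)); auto.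
  apply continuous_fst.
Qed.

Lemma continuous_snd_C {U : UniformSpace} (f : U -> C) (x : U) :
  @continuous U C_UniformSpace f x ->
  @continuous U R_UniformSpace (fun y => snd (f y)) x.
Proof.
  intros H. apply (continuous_comp f (fun z : R * R => snd z)); auto.
  apply continuous_snd.
Qed.

Section ContinuousAlgebra.
Context {U : UniformSpace}.
Implicit Types f h : U -> C.

Lemma continuous_Cplus f h x :
  @continuous U C_UniformSpace f x -> @continuous U C_UniformSpace h x ->
  @continuous U C_UniformSpace (fun y => (f y + h y)%C) x.
Proof.
  intros Hf Hh. apply continuous_C; simpl.
  - apply (@continuous_plus _ R_AbsRing R_NormedModule);
      apply continuous_fst_C; assumption.
  - apply (@continuous_plus _ R_AbsRing R_NormedModule);
      apply continuous_snd_C; assumption.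
Qed.

Lemma continuous_Copp f x :
  @continuous U C_UniformSpace f x ->
  @continuous U C_UniformSpace (fun y => (- f y)%C) x.
Proof.
  intros Hf. apply continuous_C; simpl.
  - apply (@continuous_opp _ R_AbsRing R_NormedModule), continuous_fst_C, Hf.
  - apply (@continuous_opp _ R_AbsRing R_NormedModule), continuous_snd_C, Hf.
Qed.

Lemma continuous_Cminus f h x :
  @continuous U C_UniformSpace f x -> @continuous U C_UniformSpace h x ->
  @continuous U C_UniformSpace (fun y => (f y - h y)%C) x.
Proof.
  intros Hf Hh. apply continuous_Cplus; auto using continuous_Copp.
Qed.

Lemma continuous_Cmult f h x :
  @continuous U C_UniformSpace f x -> @continuous U C_UniformSpace h x ->
  @continuous U C_UniformSpace (fun y => (f y * h y)%C) x.
Proof.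
  intros Hf Hh.
  pose proof (continuous_fst_C _ _ Hf). pose proof (continuous_snd_C _ _ Hf).
  pose proof (continuous_fst_C _ _ Hh). pose proof (continuous_snd_C _ _ Hh).
  apply continuous_C; simpl.
  - apply (@continuous_minus _ R_AbsRing R_NormedModule);
      apply (@continuous_mult _ R_AbsRing); assumption.
  - apply (@continuous_plus _ R_AbsRing R_NormedModule);
      apply (@continuous_mult _ R_AbsRing); assumption.
Qed.

Lemma continuous_Cconst (c : C) x :
  @continuous U C_UniformSpace (fun _ => c) x.
Proof. apply continuous_const. Qed.

Lemma continuous_Cpow f n x :
  @continuous U C_UniformSpace f x ->
  @continuous U C_UniformSpace (fun y => (f y ^ n)%C) x.
Proof.
  intros Hf. induction n; simpl.
  - apply continuous_Cconst.
  - apply continuous_Cmult; assumption.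
Qed.

Lemma continuous_RtoC (f : U -> R) x :
  @continuous U R_UniformSpace f x ->
  @continuous U C_UniformSpace (fun y => RtoC (f y)) x.
Proof. intros Hf. apply continuous_C; simpl; [exact Hf | apply continuous_const]. Qed.

Lemma continuous_Cinv f x :
  f x <> RtoC 0 -> @continuous U C_UniformSpace f x ->
  @continuous U C_UniformSpace (fun y => (/ f y)%C) x.
Proof.
  intros H0 Hf.
  pose proof (continuous_fst_C _ _ Hf) as H1.
  pose proof (continuous_snd_C _ _ Hf) as H2.
  assert (HD : @continuous U R_UniformSpace
    (fun y => / (fst (f y) ^ 2 + snd (f y) ^ 2)) x).
  { apply (continuous_comp (fun y => fst (f y) ^ 2 + snd (f y) ^ 2) Rinv).
    - assert (Hsq : forall a : R, @continuous R_UniformSpace R_UniformSpace (fun a => a ^ 2) a).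
      { intros a. apply (@ex_derive_continuous R_AbsRing R_NormedModule).
        auto_derive; exact I. }
      apply (@continuous_plus _ R_AbsRing R_NormedModule).
      + apply (continuous_comp (fun y => fst (f y)) (fun a => a ^ 2)); auto.
      + apply (continuous_comp (fun y => snd (f y)) (fun a => a ^ 2)); auto.
    - apply continuity_pt_filterlim, continuity_pt_inv.
      + apply continuity_pt_id.
      + intros E. apply H0. destruct (f x) as [a b]; simpl in *.
        assert (a = 0) by nra. assert (b = 0) by nra. subst; reflexivity. }
  apply continuous_C; simpl.
  - apply (@continuous_mult _ R_AbsRing); assumption.
  - apply (@continuous_mult _ R_AbsRing); try assumption.
    apply (@continuous_opp _ R_AbsRing R_NormedModule); assumption.
Qed.

End ContinuousAlgebra.

Lemma continuous_Cid (z : C) : @continuous C_UniformSpace C_UniformSpace (fun w => w) z.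
Proof. apply continuous_id. Qed.

Lemma continuous_C_comp {U : UniformSpace} (f : U -> C) (h : C -> C) (x : U) :
  @continuous U C_UniformSpace f x -> @continuous C_UniformSpace C_UniformSpace h (f x) ->
  @continuous U C_UniformSpace (fun y => h (f y)) x.
Proof. intros Hf Hh. apply (continuous_comp f h); assumption. Qed.

Lemma continuous_C_ext_loc {U : UniformSpace} (f h : U -> C) (x : U) :
  locally x (fun y => f y = h y) -> @continuous U C_UniformSpace f x ->
  @continuous U C_UniformSpace h x.
Proof.
  intros He Hf. pose proof (locally_singleton _ _ He) as E.
  apply continuous_Cmod. intros e he.
  generalize (filter_and _ _ He (proj1 (continuous_Cmod _ _) Hf e he)).
  apply filter_imp. intros y [H1 H2]. rewrite <- H1, <- E. exact H2.
Qed.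

(* Dispatches on the syntax: blind [apply]s would let unification unfold the
   complex operations. *)
Ltac ccont := repeat
  match goal with
  | |- continuous (fun _ => ?c) _ => apply continuous_const
  | |- continuous (fun y => Cplus _ _) _ => apply continuous_Cplus
  | |- continuous (fun y => Cminus _ _) _ => apply continuous_Cminus
  | |- continuous (fun y => Copp _) _ => apply continuous_Copp
  | |- continuous (fun y => Cmult _ _) _ => apply continuous_Cmult
  | |- continuous (fun y => Cpow _ _) _ => apply continuous_Cpow
  | |- continuous (fun y => RtoC _) _ => apply continuous_RtoC
  | |- continuous RtoC _ => apply (continuous_RtoC (fun y => y))
  | |- continuous (fun y => y) _ => apply continuous_id
  | _ => eassumption
  end.

(** * Complex sequences and sums *)

Definition lim_C (u : nat -> C) (l : C) : Prop :=
  forall eps, 0 < eps -> exists N, forall n, (N <= n)%nat -> Cmod (u n - l) < eps.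

Lemma lim_C_unique u l l' : lim_C u l -> lim_C u l' -> l = l'.
Proof.
  intros H H'. apply eq_of_Cmod_le; intros e he.
  destruct (H (e / 2)) as [N HN]; [lra|]. destruct (H' (e / 2)) as [N' HN']; [lra|].
  specialize (HN (max N N') ltac:(lia)). specialize (HN' (max N N') ltac:(lia)).
  pose proof (Cmod_triangle_minus l (u (max N N')) l').
  rewrite (Cmod_minus_sym l (u _)) in H0.
  lra.
Qed.

Lemma lim_C_Cmod_le u l B :
  lim_C u l -> (exists N, forall n, (N <= n)%nat -> Cmod (u n) <= B) -> Cmod l <= B.
Proof.
  intros H [N HN]. apply le_epsilon; intros e he.
  destruct (H e he) as [N' HN'].
  specialize (HN (max N N') ltac:(lia)). specialize (HN' (max N N') ltac:(lia)).
  pose proof (Cmod_minus_le l (u (max N N'))). rewrite Cmod_minus_sym in HN'. lra.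
Qed.

Lemma lim_C_ext u v l : (forall n, u n = v n) -> lim_C u l -> lim_C v l.
Proof.
  intros E H e he. destruct (H e he) as [N HN]. exists N; intros n hn.
  rewrite <- E; auto.
Qed.

Lemma lim_C_minus_const u l c : lim_C u l -> lim_C (fun n => u n - c)%C (l - c)%C.
Proof.
  intros H e he. destruct (H e he) as [N HN]. exists N; intros n hn.
  replace (u n - c - (l - c))%C with (u n - l)%C by ring. auto.
Qed.

Lemma lim_C_minus u l v m :
  lim_C u l -> lim_C v m -> lim_C (fun n => u n - v n)%C (l - m)%C.
Proof.
  intros H H' e he. destruct (H (e / 2)) as [N HN]; [lra|].
  destruct (H' (e / 2)) as [N' HN']; [lra|].
  exists (max N N'); intros n hn.
  specialize (HN n ltac:(lia)). specialize (HN' n ltac:(lia)).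
  replace (u n - v n - (l - m))%C with ((u n - l) - (v n - m))%C by ring.
  eapply Rle_lt_trans; [apply Cmod_triangle|]. rewrite Cmod_opp. lra.
Qed.

Lemma lim_C_mult_l c u l : lim_C u l -> lim_C (fun n => c * u n)%C (c * l)%C.
Proof.
  intros H e he. pose proof (Cmod_ge_0 c).
  destruct (H (e / (Cmod c + 1))) as [N HN]; [apply Rdiv_lt_0_compat; lra|].
  exists N; intros n hn. specialize (HN n hn).
  replace (c * u n - c * l)%C with (c * (u n - l))%C by ring.
  rewrite Cmod_mult. pose proof (Cmod_ge_0 (u n - l)).
  apply Rmult_lt_compat_r with (r := Cmod c + 1) in HN; [|lra].
  replace (e / (Cmod c + 1) * (Cmod c + 1)) with e in HN by (field; lra). nra.
Qed.

Lemma lim_C_of_bound u l (b : nat -> R) :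
  (forall n, Cmod (u n - l) <= b n) -> is_lim_seq b 0 -> lim_C u l.
Proof.
  intros H Hb e he. apply is_lim_seq_spec in Hb.
  destruct (Hb (mkposreal e he)) as [N HN]. exists N; intros n hn.
  specialize (HN n hn); simpl in HN. rewrite Rminus_0_r in HN.
  eapply Rle_lt_trans; [apply H|]. eapply Rle_lt_trans; [apply Rle_abs | exact HN].
Qed.

Lemma is_lim_seq_geom_scal A q :
  0 <= q < 1 -> is_lim_seq (fun n => A * q ^ n) 0.
Proof.
  intros hq. replace (Finite 0) with (Rbar_mult A 0)
    by (simpl; f_equal; ring).
  apply is_lim_seq_scal_l, is_lim_seq_geom. rewrite Rabs_pos_eq; lra.
Qed.

(** The limit inherits the rate [e n]: fix [n] and let [m] grow. The type [X] is free because the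
    lemma serves pairs of points, the closed disc and single points. *)
Lemma uniform_cauchy_lim {X : Type} (D : X -> Prop) (S : nat -> X -> C) (e : nat -> R) :
  is_lim_seq e 0 ->
  (forall n m x, D x -> (n <= m)%nat -> Cmod (S m x - S n x) <= e n) ->
  exists F : X -> C, forall n x, D x -> Cmod (F x - S n x) <= e n.
Proof.
  intros He HS.
  (* [Lim_seq] is total, so the limit can be named before convergence is known; its values outside
     [D] are irrelevant. *)
  exists (fun x => (real (Lim_seq (fun n => fst (S n x))), real (Lim_seq (fun n => snd (S n x))))).
  intros n x hx.
  assert (HC : forall p : C -> R, (forall z w, p z - p w = p (z - w)%C) ->
     (forall z, Rabs (p z) <= Cmod z) ->
     is_lim_seq (fun n => p (S n x)) (real (Lim_seq (fun n => p (S n x))))).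
  { intros p p1 p2. apply Lim_seq_correct'. apply ex_lim_seq_cauchy_corr.
    intros eps. apply is_lim_seq_spec in He.
    assert (h2 : 0 < eps / 2) by (pose proof (cond_pos eps); lra).
    destruct (He (mkposreal _ h2)) as [N HN]. exists N.
    assert (key : forall n, (N <= n)%nat -> Rabs (p (S n x) - p (S N x)) < eps / 2).
    { intros k hk. rewrite p1. eapply Rle_lt_trans; [apply p2|].
      eapply Rle_lt_trans; [apply HS; auto|].
      specialize (HN N ltac:(lia)); simpl in HN. rewrite Rminus_0_r in HN.
      eapply Rle_lt_trans; [apply Rle_abs | exact HN]. }
    intros k l hk hl. pose proof (key k hk). pose proof (key l hl).
    replace (p (S k x) - p (S l x)) with ((p (S k x) - p (S N x)) - (p (S l x) - p (S N x))) by ring.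
    eapply Rle_lt_trans; [apply Rabs_triang|]. rewrite Rabs_Ropp. lra. }
  pose proof (HC fst (fun z w => eq_refl) fst_le_Cmod) as L1.
  pose proof (HC snd (fun z w => eq_refl) snd_le_Cmod) as L2.
  set (l := (_, _)).
  assert (L : lim_C (fun n => S n x) l).
  { intros eps he. assert (h2 : 0 < eps / 2) by lra.
    apply is_lim_seq_spec in L1. apply is_lim_seq_spec in L2.
    destruct (L1 (mkposreal _ h2)) as [N1 H1]. destruct (L2 (mkposreal _ h2)) as [N2 H2].
    exists (max N1 N2); intros k hk.
    specialize (H1 k ltac:(lia)). specialize (H2 k ltac:(lia)). simpl in H1, H2.
    eapply Rle_lt_trans; [apply Cmod_le_Rabs|]. simpl.
    unfold Rminus in H1, H2. lra. }
  rewrite Cmod_minus_sym.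
  apply (lim_C_Cmod_le (fun m => S n x - S m x)%C).
  - intros eps he. destruct (L eps he) as [N HN]. exists N; intros k hk.
    replace (S n x - S k x - (S n x - l))%C with (- (S k x - l))%C by ring.
    rewrite Cmod_opp; auto.
  - exists n. intros k hk. rewrite Cmod_minus_sym. auto.
Qed.

(** Indices run over [k < n], unlike [sum_n], so that a geometric tail after [n] terms is a multiple
    of [q ^ n]. *)
Fixpoint psum (F : nat -> C) (n : nat) : C :=
  match n with O => 0%C | S n => (psum F n + F n)%C end.

Lemma psum_ext F G n : (forall k, (k < n)%nat -> F k = G k) -> psum F n = psum G n.
Proof.
  induction n; simpl; intros H; [reflexivity|].
  rewrite IHn by (intros; apply H; lia). rewrite H by lia. reflexivity.
Qed.

Lemma psum_mult_r F c n : (psum F n * c = psum (fun k => F k * c) n)%C.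
Proof. induction n; simpl; [ring|]. rewrite <- IHn; ring. Qed.

Lemma psum_minus F G n : (psum F n - psum G n = psum (fun k => F k - G k) n)%C.
Proof. induction n; simpl; [ring|]. rewrite <- IHn; ring. Qed.

Lemma psum_S_l F n : psum F (S n) = (F O + psum (fun k => F (S k)) n)%C.
Proof. induction n; [simpl; ring|]. change (psum F (S (S n))) with (psum F (S n) + F (S n))%C.
  rewrite IHn; simpl; ring. Qed.

Lemma psum_zero n : psum (fun _ => RtoC 0) n = RtoC 0.
Proof. induction n; simpl; [reflexivity|]. rewrite IHn. ring. Qed.

Lemma psum_geom_cauchy F A q n m :
  0 <= q < 1 -> (forall k, Cmod (F k) <= A * q ^ k) -> (n <= m)%nat ->
  Cmod (psum F m - psum F n) <= A / (1 - q) * q ^ n.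
Proof.
  intros hq H hnm.
  assert (hA : 0 <= A).
  { specialize (H O); simpl in H. pose proof (Cmod_ge_0 (F O)). lra. }
  (* The exact value of the geometric sum, stronger than the goal, is what survives the induction on
     [m]. *)
  cut (Cmod (psum F m - psum F n) <= A / (1 - q) * (q ^ n - q ^ m)).
  { intros K. eapply Rle_trans; [exact K|]. apply Rmult_le_compat_l.
    - apply Rdiv_le_0_compat; lra.
    - pose proof (pow_le q m (proj1 hq)); lra. }
  induction hnm as [|m hnm IH].
  - replace (psum F n - psum F n)%C with (RtoC 0) by ring. rewrite Cmod_0. lra.
  - simpl psum. replace (psum F m + F m - psum F n)%C with ((psum F m - psum F n) + F m)%C by ring.
    eapply Rle_trans; [apply Cmod_triangle|]. specialize (H m).
    replace (A / (1 - q) * (q ^ n - q ^ S m)) with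
      (A / (1 - q) * (q ^ n - q ^ m) + A * q ^ m) by (simpl; field; lra). lra.
Qed.

Lemma continuous_psum {U : UniformSpace} (F : nat -> U -> C) n x :
  (forall k, @continuous U C_UniformSpace (F k) x) ->
  @continuous U C_UniformSpace (fun y => psum (fun k => F k y) n) x.
Proof.
  intros H. induction n; simpl; [apply continuous_Cconst|].
  apply continuous_Cplus; auto.
Qed.

Lemma continuous_uniform_lim {U : UniformSpace} (S : nat -> U -> C) (F : U -> C)
    (e : nat -> R) (x : U) :
  is_lim_seq e 0 ->
  locally x (fun y => forall n, Cmod (F y - S n y) <= e n) ->
  (forall n, @continuous U C_UniformSpace (S n) x) ->
  @continuous U C_UniformSpace F x.
Proof.
  intros He HU HS. apply continuous_Cmod. intros eps he.
  apply is_lim_seq_spec in He.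
  assert (h3 : 0 < eps / 3) by lra.
  destruct (He (mkposreal _ h3)) as [N HN]. specialize (HN N ltac:(lia)).
  simpl in HN. rewrite Rminus_0_r in HN. apply Rabs_def2 in HN.
  pose proof (locally_singleton _ _ HU N) as Hx.
  generalize (filter_and _ _ HU (proj1 (continuous_Cmod _ _) (HS N) _ h3)).
  apply filter_imp. intros y [Hy H]. specialize (Hy N).
  replace (F y - F x)%C with ((F y - S N y) + (S N y - S N x) - (F x - S N x))%C by ring.
  eapply Rle_lt_trans; [apply Cmod_triangle|]. rewrite Cmod_opp.
  eapply Rle_lt_trans; [apply Rplus_le_compat_r, Cmod_triangle|]. lra.
Qed.

Lemma is_pseries_lim_C (a : nat -> C) (u l : C) :
  @is_pseries C_AbsRing C_NormedModule a u l <->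
  lim_C (fun n => psum (fun k => a k * u ^ k)%C n) l.
Proof.
  assert (E : forall n, sum_n (fun k => @scal _ C_NormedModule (pow_n (K := C_AbsRing) u k) (a k)) n
            = psum (fun k => a k * u ^ k)%C (S n)).
  { assert (P : forall k, @pow_n C_AbsRing u k = (u ^ k)%C).
    { induction k; simpl; [reflexivity|]. rewrite IHk; reflexivity. }
    induction n.
    - rewrite sum_O. change (1 * a O = 0 + a O * 1)%C. ring.
    - rewrite sum_Sn, IHn. simpl psum. rewrite (P (S n)).
      change (psum (fun k => a k * u ^ k) n + a n * u ^ n + (u ^ S n * a (S n)) =
        psum (fun k => a k * u ^ k) n + a n * u ^ n + a (S n) * u ^ S n)%C. ring. }
  unfold is_pseries, is_series. split.
  - intros H e he.
    pose proof (proj1 (filterlim_Cmod eventually _ l) H e he) as [N HN].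
    exists (S N). intros [|n] hn; [lia|]. rewrite <- E. apply HN. lia.
  - intros H. apply (filterlim_Cmod eventually). intros e he.
    destruct (H e he) as [N HN]. exists N. intros n hn. rewrite E. apply HN. lia.
Qed.

(** * Complex-valued functions of a real variable *)

Definition CInt (h : R -> C) (a b : R) : C := RInt (V := C_R_CompleteNormedModule) h a b.

Definition ccont (h : R -> C) (t : R) : Prop := @continuous R_UniformSpace C_UniformSpace h t.

Lemma CInt_correct h a b : a <= b -> (forall t, a <= t <= b -> ccont h t) ->
  @is_RInt C_R_NormedModule h a b (CInt h a b).
Proof.
  intros hab H.
  apply (@RInt_correct C_R_CompleteNormedModule), (@ex_RInt_continuous C_R_CompleteNormedModule).
  rewrite Rmin_left, Rmax_right by assumption. exact H.
Qed.

Lemma CInt_unique h a b l : @is_RInt C_R_NormedModule h a b l -> CInt h a b = l.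
Proof. apply (@is_RInt_unique C_R_CompleteNormedModule). Qed.

Lemma CInt_ext h k a b : a <= b -> (forall t, a <= t <= b -> h t = k t) ->
  CInt h a b = CInt k a b.
Proof.
  intros hab H. apply (@RInt_ext C_R_CompleteNormedModule).
  rewrite Rmin_left, Rmax_right by assumption. intros t ht; apply H; lra.
Qed.

Lemma CInt_plus h k a b : a <= b ->
  (forall t, a <= t <= b -> ccont h t) -> (forall t, a <= t <= b -> ccont k t) ->
  CInt (fun t => h t + k t)%C a b = (CInt h a b + CInt k a b)%C.
Proof.
  intros hab Hh Hk. apply CInt_unique.
  apply (@is_RInt_plus C_R_NormedModule); apply CInt_correct; assumption.
Qed.

Lemma CInt_minus h k a b : a <= b ->
  (forall t, a <= t <= b -> ccont h t) -> (forall t, a <= t <= b -> ccont k t) ->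
  CInt (fun t => h t - k t)%C a b = (CInt h a b - CInt k a b)%C.
Proof.
  intros hab Hh Hk. apply CInt_unique.
  apply (@is_RInt_minus C_R_NormedModule); apply CInt_correct; assumption.
Qed.

Lemma is_RInt_fst h a b l : @is_RInt C_R_NormedModule h a b l ->
  @is_RInt R_NormedModule (fun t => fst (h t)) a b (fst l).
Proof. apply (@is_RInt_fct_extend_fst R_NormedModule R_NormedModule). Qed.

Lemma is_RInt_snd h a b l : @is_RInt C_R_NormedModule h a b l ->
  @is_RInt R_NormedModule (fun t => snd (h t)) a b (snd l).
Proof. apply (@is_RInt_fct_extend_snd R_NormedModule R_NormedModule). Qed.

Lemma is_RInt_C h a b (l : C) :
  @is_RInt R_NormedModule (fun t => fst (h t)) a b (fst l) ->
  @is_RInt R_NormedModule (fun t => snd (h t)) a b (snd l) ->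
  @is_RInt C_R_NormedModule h a b l.
Proof.
  intros H1 H2. rewrite (surjective_pairing l).
  apply (@is_RInt_fct_extend_pair R_NormedModule R_NormedModule); assumption.
Qed.

(** The integral lives in a real normed module, whose linearity covers real scalars only; a complex
    factor mixes the coordinates and is treated there. *)
Lemma CInt_scal h c a b : a <= b ->
  (forall t, a <= t <= b -> ccont h t) ->
  CInt (fun t => c * h t)%C a b = (c * CInt h a b)%C.
Proof.
  intros hab H. apply CInt_unique.
  pose proof (is_RInt_fst _ _ _ _ (CInt_correct h a b hab H)) as H1.
  pose proof (is_RInt_snd _ _ _ _ (CInt_correct h a b hab H)) as H2.
  apply is_RInt_C; simpl.
  - apply (@is_RInt_minus R_NormedModule);
      apply (@is_RInt_scal R_NormedModule); assumption.
  - apply (@is_RInt_plus R_NormedModule);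
      apply (@is_RInt_scal R_NormedModule); assumption.
Qed.

Lemma CInt_bound h a b M : a <= b ->
  (forall t, a <= t <= b -> ccont h t) ->
  (forall t, a <= t <= b -> Cmod (h t) <= M) ->
  Cmod (CInt h a b) <= (b - a) * M.
Proof.
  intros hab Hc HM.
  rewrite Cmod_norm.
  apply (@norm_RInt_le C_R_NormedModule h (fun _ => M) a b (CInt h a b)); auto.
  - intros x hx. rewrite <- Cmod_norm. auto.
  - apply CInt_correct; assumption.
  - apply (@is_RInt_const R_NormedModule).
Qed.

(** Kept coordinatewise so that the real fundamental theorem and differentiation under the integral
    apply to it. *)
Definition rdiff (gam : R -> C) (t : R) (d : C) : Prop :=
  is_derive (fun s => fst (gam s)) t (fst d) /\ is_derive (fun s => snd (gam s)) t (snd d).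

Lemma CInt_derive h k a b : a <= b ->
  (forall t, a <= t <= b -> rdiff h t (k t)) ->
  (forall t, a <= t <= b -> ccont k t) ->
  CInt k a b = (h b - h a)%C.
Proof.
  intros hab H Hc. apply CInt_unique.
  apply is_RInt_C.
  - apply (@is_RInt_derive R_CompleteNormedModule (fun t => fst (h t)) (fun t => fst (k t)));
      rewrite Rmin_left, Rmax_right by assumption; intros t ht.
    + apply H; assumption.
    + apply continuous_fst_C, Hc, ht.
  - apply (@is_RInt_derive R_CompleteNormedModule (fun t => snd (h t)) (fun t => snd (k t)));
      rewrite Rmin_left, Rmax_right by assumption; intros t ht.
    + apply H; assumption.
    + apply continuous_snd_C, Hc, ht.
Qed.

Lemma caratheodory_is_derive (f psi : R -> R) t :
  (forall s, f s = f t + psi s * (s - t)) ->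
  @continuous R_UniformSpace R_UniformSpace psi t -> is_derive f t (psi t).
Proof.
  intros E H. apply is_derive_Reals. intros eps he.
  destruct (proj1 (filterlim_locally _ _) H (mkposreal eps he)) as [d Hd].
  exists d. intros h h0 hd. rewrite (E (t + h)).
  replace ((f t + psi (t + h) * (t + h - t) - f t) / h - psi t) with (psi (t + h) - psi t)
    by (field; assumption).
  apply Hd. change (Rabs (t + h - t) < d). replace (t + h - t) with h by ring. exact hd.
Qed.

Lemma is_derive_caratheodory (f : R -> R) t l : is_derive f t l ->
  exists psi : R -> R, @continuous R_UniformSpace R_UniformSpace psi t /\ psi t = l /\
    forall s, f s = f t + psi s * (s - t).
Proof.
  intros H.
  exists (fun s => if Req_EM_T s t then l else (f s - f t) / (s - t)).
  destruct (Req_EM_T t t) as [_|n]; [|now elim n]. repeat split.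
  - apply is_derive_Reals in H.
    apply (proj2 (@filterlim_locally R R_UniformSpace (locally t) _ _ _)). intros eps.
    destruct (H eps (cond_pos eps)) as [d Hd]. exists d. intros s hs.
    destruct (Req_EM_T t t) as [_|n]; [|now elim n].
    destruct (Req_EM_T s t) as [_|n].
    + apply ball_center.
    + specialize (Hd (s - t) ltac:(lra) hs). change R in s. replace (t + (s - t)) with s in Hd by exact (eq_sym (Rplus_minus t s)).
      exact Hd.
  - intros s. destruct (Req_EM_T s t) as [->|n]; [ring | field; lra].
Qed.

Lemma rdiff_caratheodory gam t d : rdiff gam t d <->
  exists psi : R -> C, ccont psi t /\ psi t = d /\
    forall s, gam s = (gam t + psi s * RtoC (s - t))%C.
Proof.
  split.
  - intros [H1 H2].
    destruct (is_derive_caratheodory _ _ _ H1) as [p1 [c1 [e1 E1]]].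
    destruct (is_derive_caratheodory _ _ _ H2) as [p2 [c2 [e2 E2]]].
    exists (fun s => (p1 s, p2 s)). repeat split.
    + apply continuous_C; assumption.
    + rewrite e1, e2. symmetry; apply surjective_pairing.
    + intros s. rewrite (surjective_pairing (gam s)), E1, E2.
      apply injective_projections; simpl; ring.
  - intros [psi [Hc [He E]]]. subst d. split.
    + apply (caratheodory_is_derive _ (fun s => fst (psi s))).
      * intros s. rewrite (E s). simpl. ring.
      * apply continuous_fst_C, Hc.
    + apply (caratheodory_is_derive _ (fun s => snd (psi s))).
      * intros s. rewrite (E s). simpl. ring.
      * apply continuous_snd_C, Hc.
Qed.

Lemma rdiff_continuous gam t d : rdiff gam t d -> ccont gam t.
Proof.
  intros [H1 H2]. apply continuous_C; apply (@ex_derive_continuous R_AbsRing R_NormedModule);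
    eexists; eassumption.
Qed.

Lemma rdiff_affine (a b : C) t : rdiff (fun s => a + RtoC s * b)%C t b.
Proof.
  apply rdiff_caratheodory. exists (fun _ => b). repeat split.
  - apply continuous_const.
  - intros s. rewrite RtoC_minus. ring.
Qed.

Lemma rdiff_mult_l (c : C) gam t d : rdiff gam t d -> rdiff (fun s => c * gam s)%C t (c * d)%C.
Proof.
  rewrite !rdiff_caratheodory. intros [psi [Hc [He E]]].
  exists (fun s => c * psi s)%C. repeat split.
  - apply continuous_Cmult; [apply continuous_Cconst | exact Hc].
  - now rewrite He.
  - intros s. rewrite (E s). ring.
Qed.

Lemma rdiff_plus_l (c : C) gam t d : rdiff gam t d -> rdiff (fun s => c + gam s)%C t d.
Proof.
  rewrite !rdiff_caratheodory. intros [psi [Hc [He E]]].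
  exists psi. repeat split; auto. intros s. rewrite (E s). ring.
Qed.

Definition cis (t : R) : C := (cos t, sin t).

Lemma Cmod_cis t : Cmod (cis t) = 1.
Proof.
  unfold Cmod, cis; simpl. transitivity (sqrt 1); [f_equal | apply sqrt_1].
  pose proof (sin2_cos2 t). unfold Rsqr in H. lra.
Qed.

Lemma cis_neq_0 t : cis t <> 0%C.
Proof. apply Cmod_gt_0. rewrite Cmod_cis. lra. Qed.

Lemma rdiff_cis t : rdiff cis t (Ci * cis t)%C.
Proof. split; simpl; auto_derive; auto; ring. Qed.

Lemma cis_2PI : cis (2 * PI) = cis 0.
Proof. unfold cis. now rewrite cos_2PI, sin_2PI, cos_0, sin_0. Qed.

(** * Complex differentiability in the sense of Caratheodory *)

(** With a slope function continuous at [z], the sum, product and chain rules reduce to ring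
    identities between slopes. *)
Definition cdiff (f : C -> C) (z l : C) : Prop :=
  exists phi : C -> C, @continuous C_UniformSpace C_UniformSpace phi z /\ phi z = l /\
    forall w, f w = (f z + phi w * (w - z))%C.

(** The identity in [cdiff] is global, but away from [z] the difference quotient always satisfies
    it, so a slope given near [z] is enough. *)
Lemma cdiff_intro f (phi : C -> C) z d :
  0 < d -> (forall w, Cmod (w - z) < d -> f w = (f z + phi w * (w - z))%C) ->
  @continuous C_UniformSpace C_UniformSpace phi z -> cdiff f z (phi z).
Proof.
  intros hd E Hc.
  exists (fun w => if Ceq_dec w z then phi z else ((f w - f z) / (w - z))%C).
  destruct (Ceq_dec z z) as [_|n]; [|now elim n]. repeat split.
  - apply (continuous_C_ext_loc phi); [|exact Hc].
    apply locally_Cmod. exists d; split; [exact hd|]. intros w hw.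
    destruct (Ceq_dec w z) as [->|n]; [reflexivity|].
    rewrite (E w hw). field. intros H; apply n.
    replace w with (w - z + z)%C by ring. rewrite H; ring.
  - intros w. destruct (Ceq_dec w z) as [->|n]; [ring|]. field.
    intros H; apply n. replace w with (w - z + z)%C by ring. rewrite H; ring.
Qed.

Lemma cdiff_continuous f z l : cdiff f z l -> @continuous C_UniformSpace C_UniformSpace f z.
Proof.
  intros [phi [Hc [_ E]]].
  apply (continuous_C_ext_loc (fun w => f z + phi w * (w - z))%C).
  - apply locally_Cmod. exists 1. split; [lra|]. intros; now rewrite <- E.
  - ccont.
Qed.

Lemma cdiff_is_derive f z l : cdiff f z l -> @is_derive C_AbsRing C_NormedModule f z l.
Proof.
  intros [phi [Hc [<- E]]]. split; [apply is_linear_scal_l|].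
  intros z' Hz'.
  assert (z = z') by (exact (@is_filter_lim_locally_unique C_AbsRing (AbsRing_NormedModule C_AbsRing) z z' Hz')). subst z'.
  intros eps.
  (* [is_derive] over [C_AbsRing] uses the neighbourhoods of the absolute value; [locally_C]
     identifies them with those of the product. *)
  apply (proj1 (locally_C z _)), locally_Cmod.
  destruct (proj1 (locally_Cmod _ _)
    (proj1 (continuous_Cmod _ _) Hc eps (cond_pos eps))) as [d [hd Hd]].
  exists d. split; [exact hd|]. intros w hw.
  change (Cmod ((f w - f z) - (w - z) * phi z) <= eps * Cmod (w - z)).
  rewrite (E w). replace (f z + phi w * (w - z) - f z - (w - z) * phi z)%C with
    ((phi w - phi z) * (w - z))%C by ring.
  rewrite Cmod_mult. apply Rmult_le_compat_r; [apply Cmod_ge_0|]. left; auto.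
Qed.

Lemma cdiff_C_derive f z l : cdiff f z l -> C_derive f z = l.
Proof. intros H. apply is_C_derive_unique, cdiff_is_derive, H. Qed.

Lemma cdiff_rdiff f gam t l d :
  cdiff f (gam t) l -> rdiff gam t d -> rdiff (fun s => f (gam s)) t (l * d)%C.
Proof.
  intros [phi [Hc [<- E]]] H. pose proof (rdiff_continuous _ _ _ H) as Hg.
  apply rdiff_caratheodory in H. destruct H as [psi [Hp [<- Ep]]].
  apply rdiff_caratheodory. exists (fun s => phi (gam s) * psi s)%C. repeat split.
  - apply continuous_Cmult; [|exact Hp]. apply (continuous_C_comp gam phi); assumption.
  - intros s. rewrite (E (gam s)). rewrite (Ep s) at 2. ring.
Qed.

Lemma cdiff_const c z : cdiff (fun _ => c) z 0%C.
Proof. exists (fun _ => 0%C). repeat split; [apply continuous_Cconst | intros; ring]. Qed.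

Lemma cdiff_id z : cdiff (fun w => w) z 1%C.
Proof. exists (fun _ => 1%C). repeat split; [apply continuous_Cconst | intros; ring]. Qed.

Lemma cdiff_plus f h z l m : cdiff f z l -> cdiff h z m ->
  cdiff (fun w => f w + h w)%C z (l + m)%C.
Proof.
  intros [p [Cp [<- Ep]]] [q [Cq [<- Eq]]].
  exists (fun w => p w + q w)%C. repeat split; [ccont|].
  intros w. rewrite (Ep w), (Eq w). ring.
Qed.

Lemma cdiff_mult f h z l m : cdiff f z l -> cdiff h z m ->
  cdiff (fun w => f w * h w)%C z (l * h z + f z * m)%C.
Proof.
  intros Hf Hh. pose proof (cdiff_continuous _ _ _ Hh) as Ch.
  destruct Hf as [p [Cp [<- Ep]]]. destruct Hh as [q [Cq [<- Eq]]].
  exists (fun w => p w * h w + f z * q w)%C. repeat split.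
  - ccont.
  - intros w. rewrite (Ep w). rewrite (Eq w) at 1. rewrite (Eq w). ring.
Qed.

Lemma cdiff_inv (z : C) : z <> 0%C -> cdiff Cinv z (- (/ z * / z))%C.
Proof.
  intros hz. apply (cdiff_intro Cinv (fun w => - (/ w * / z))%C z (Cmod z)).
  - apply Cmod_gt_0; assumption.
  - intros w hw. assert (w <> 0%C).
    { intros ->. rewrite Cmod_minus_sym in hw.
      replace (z - 0)%C with z in hw by ring. lra. }
    field; split; assumption.
  - apply continuous_Copp, continuous_Cmult; [|apply continuous_Cconst].
    apply continuous_Cinv; [exact hz | apply continuous_Cid].
Qed.

(** The class on which Cauchy's formula is proved. It is visibly stable under sums and products and
    contains [Cinv] away from 0; [analytic_at_iff_C1] identifies it with analyticity. *)
Definition C1_at (f : C -> C) (z : C) : Prop :=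
  exists (f1 : C -> C) (d : R), 0 < d /\ forall w, Cmod (w - z) < d ->
    cdiff f w (f1 w) /\ @continuous C_UniformSpace C_UniformSpace f1 w.

Lemma C1_at_continuous f z : C1_at f z -> @continuous C_UniformSpace C_UniformSpace f z.
Proof.
  intros [f1 [d [hd H]]]. apply (cdiff_continuous f z (f1 z)), H.
  replace (z - z)%C with (RtoC 0) by ring. now rewrite Cmod_0.
Qed.

(** Ties the local derivative to the total function [C_derive], in terms of which [Vop] is
    written. *)
Lemma C1_at_C_derive f z : C1_at f z ->
  cdiff f z (C_derive f z) /\ @continuous C_UniformSpace C_UniformSpace (C_derive f) z.
Proof.
  intros [f1 [d [hd H]]].
  assert (h0 : Cmod (z - z) < d).
  { replace (z - z)%C with (RtoC 0) by ring. now rewrite Cmod_0. }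
  split.
  - rewrite (cdiff_C_derive f z (f1 z)); apply H, h0.
  - apply (continuous_C_ext_loc f1); [|apply H, h0].
    apply locally_Cmod. exists d. split; [exact hd|]. intros w hw.
    symmetry. apply cdiff_C_derive, H, hw.
Qed.

Lemma C1_at_plus f h z : C1_at f z -> C1_at h z -> C1_at (fun w => f w + h w)%C z.
Proof.
  intros [f1 [d [hd H]]] [h1 [d' [hd' H']]].
  exists (fun w => f1 w + h1 w)%C, (Rmin d d'). split; [now apply Rmin_pos|].
  intros w hw.
  destruct (H w) as [Hf Cf]; [eapply Rlt_le_trans; [exact hw | apply Rmin_l]|].
  destruct (H' w) as [Hh Ch]; [eapply Rlt_le_trans; [exact hw | apply Rmin_r]|].
  split; [now apply cdiff_plus | ccont].
Qed.

Lemma C1_at_mult f h z : C1_at f z -> C1_at h z -> C1_at (fun w => f w * h w)%C z.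
Proof.
  intros [f1 [d [hd H]]] [h1 [d' [hd' H']]].
  exists (fun w => f1 w * h w + f w * h1 w)%C, (Rmin d d'). split; [now apply Rmin_pos|].
  intros w hw.
  destruct (H w) as [Hf Cf]; [eapply Rlt_le_trans; [exact hw | apply Rmin_l]|].
  destruct (H' w) as [Hh Ch]; [eapply Rlt_le_trans; [exact hw | apply Rmin_r]|].
  split; [now apply cdiff_mult|].
  pose proof (cdiff_continuous _ _ _ Hf). pose proof (cdiff_continuous _ _ _ Hh). ccont.
Qed.

Lemma C1_at_const c z : C1_at (fun _ => c) z.
Proof.
  exists (fun _ => 0%C), 1. split; [lra|]. intros w _.
  split; [apply cdiff_const | apply continuous_Cconst].
Qed.

Lemma C1_at_id z : C1_at (fun w => w) z.
Proof.
  exists (fun _ => 1%C), 1. split; [lra|]. intros w _.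
  split; [apply cdiff_id | apply continuous_Cconst].
Qed.

Lemma C1_at_pow n z : C1_at (fun w => w ^ n)%C z.
Proof.
  induction n; simpl; [apply C1_at_const|]. apply C1_at_mult; [apply C1_at_id | exact IHn].
Qed.

Lemma C1_at_inv (z : C) : z <> 0%C -> C1_at Cinv z.
Proof.
  intros hz. exists (fun w => - (/ w * / w))%C, (Cmod z).
  split; [apply Cmod_gt_0; assumption|]. intros w hw.
  assert (hw0 : w <> 0%C).
  { intros ->. rewrite Cmod_minus_sym in hw. replace (z - 0)%C with z in hw by ring. lra. }
  split; [now apply cdiff_inv|].
  apply continuous_Copp, continuous_Cmult; apply continuous_Cinv; auto using continuous_Cid.
Qed.

(** * Power series are continuously differentiable *)

(** The polynomial that extends [(u ^ n - v ^ n) / (u - v)] to the diagonal [u = v]. *)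
Fixpoint pow_quot (u v : C) (n : nat) : C :=
  match n with O => 0%C | S n => (u * pow_quot u v n + v ^ n)%C end.

Lemma pow_quot_spec u v n : (u ^ n - v ^ n = pow_quot u v n * (u - v))%C.
Proof.
  induction n; simpl; [ring|].
  replace (u * u ^ n - v * v ^ n)%C with (u * (u ^ n - v ^ n) + v ^ n * (u - v))%C by ring.
  rewrite IHn; ring.
Qed.

(** The factor [r] on the left avoids the exponent [n - 1], which would be wrong at [n = 0]. *)
Lemma pow_quot_bound u v n r : Cmod u <= r -> Cmod v <= r ->
  Cmod (pow_quot u v n) * r <= INR n * r ^ n.
Proof.
  intros hu hv. assert (hr : 0 <= r) by (pose proof (Cmod_ge_0 u); lra).
  induction n; [simpl; rewrite Cmod_0; lra|].
  rewrite S_INR. simpl.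
  assert (Cmod (u * pow_quot u v n + v ^ n) <= r * Cmod (pow_quot u v n) + r ^ n).
  { eapply Rle_trans; [apply Cmod_triangle|]. rewrite Cmod_mult, Cmod_pow.
    apply Rplus_le_compat.
    - apply Rmult_le_compat_r; [apply Cmod_ge_0 | exact hu].
    - apply pow_incr; split; [apply Cmod_ge_0 | exact hv]. }
  apply Rmult_le_compat_r with (r := r) in H; [|exact hr].
  pose proof (pow_le r n hr). nra.
Qed.

Lemma eventually_bounded (u : nat -> R) B N :
  (forall n, (N <= n)%nat -> u n <= B) -> exists M, 0 < M /\ forall n, u n <= M.
Proof.
  intros H. induction N in B, H |- *.
  - exists (Rmax B 1). split; [eapply Rlt_le_trans; [|apply Rmax_r]; lra|].
    intros n. eapply Rle_trans; [apply H; lia | apply Rmax_l].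
  - apply (IHN (Rmax B (u N))). intros n hn.
    destruct (Nat.eq_dec n N) as [->|]; [apply Rmax_r|].
    eapply Rle_trans; [apply H; lia | apply Rmax_l].
Qed.

Lemma INR_le_pow2 n : INR n <= 2 ^ n.
Proof.
  induction n; [simpl; lra|]. rewrite S_INR. simpl.
  assert (1 <= 2 ^ n) by (apply pow_R1_Rle; lra). lra.
Qed.

(** The difference quotient as a function of two points is a locally uniform limit of polynomials,
    hence jointly continuous. Restricted to one variable it gives the derivative at every nearby
    point; restricted to the diagonal it gives the continuity of that derivative. *)
Lemma analytic_at_diff_quot f z : analytic_at f z ->
  exists (Phi : C -> C -> C) (d : R), 0 < d /\
  forall w v, Cmod (w - z) < d -> Cmod (v - z) < d ->
    f w = (f v + Phi w v * (w - v))%C /\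
    @continuous (prod_UniformSpace C_UniformSpace C_UniformSpace) C_UniformSpace
      (fun p => Phi (fst p) (snd p)) (w, v).
Proof.
  intros [a [r Hr]]. pose proof (cond_pos r) as hr.
  (* Convergence at radius [r / 2] bounds the coefficients. A further factor 4 is taken off the
     radius: one 2 absorbs the [n] of [pow_quot_bound], the other leaves the geometric rate
     [(/ 2) ^ n]. *)
  set (rho := r / 8).
  assert (hrho : 0 < rho) by (unfold rho; lra).
  assert (hrr : rho < r) by (unfold rho; lra).
  assert (Hser : forall u, Cmod u < r -> lim_C (fun n => psum (fun k => a k * u ^ k)%C n) (f (z + u)%C)).
  { intros u hu. apply is_pseries_lim_C.
    specialize (Hr (z + u)%C). replace (z + u - z)%C with u in Hr by ring. auto. }
  (* A term is the difference of two consecutive partial sums, both eventually within 1 of the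
     limit; hence the eventual bound 2. *)
  assert (HM : exists M, 0 < M /\ forall n, Cmod (a n) * (r / 2) ^ n <= M).
  { assert (hu : Cmod (RtoC (r / 2)) < r) by (rewrite Cmod_R, Rabs_pos_eq; lra).
    destruct (Hser _ hu 1 Rlt_0_1) as [N HN].
    apply (eventually_bounded _ 2 N). intros n hn.
    pose proof (HN n hn) as H1. pose proof (HN (S n) ltac:(lia)) as H2.
    simpl in H2.
    replace (Cmod (a n) * (r / 2) ^ n) with (Cmod (a n * RtoC (r / 2) ^ n)%C).
    2:{ rewrite Cmod_mult, Cmod_pow, Cmod_R, (Rabs_pos_eq (r / 2)); [reflexivity | lra]. }
    set (s := psum _ n) in *. set (x := (a n * _)%C) in *.
    replace x with ((s + x - f (z + RtoC (r / 2))) - (s - f (z + RtoC (r / 2))))%C by ring.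
    eapply Rle_trans; [apply Cmod_triangle|]. rewrite Cmod_opp. lra. }
  destruct HM as [M [hM HM]].
  assert (Hb : forall u v, Cmod u <= rho -> Cmod v <= rho -> forall n,
    Cmod (a n * pow_quot u v n)%C <= M / rho * (/ 2) ^ n).
  { intros u v hu hv n. rewrite Cmod_mult.
    apply Rmult_le_reg_r with rho; [exact hrho|].
    replace (M / rho * (/ 2) ^ n * rho) with (M * (/ 2) ^ n) by (field; lra).
    rewrite Rmult_assoc.
    eapply Rle_trans; [apply Rmult_le_compat_l; [apply Cmod_ge_0 | apply pow_quot_bound; eassumption]|].
    replace rho with ((r / 2) * (/ 2 * / 2)) by (unfold rho; field).
    rewrite !Rpow_mult_distr.
    pose proof (INR_le_pow2 n) as h2.
    assert (e2 : (/ 2) ^ n * 2 ^ n = 1).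
    { rewrite <- Rpow_mult_distr. replace (/ 2 * 2) with 1 by field. apply pow1. }
    assert (hp : 0 < (/ 2) ^ n) by (apply pow_lt; lra).
    replace (Cmod (a n) * (INR n * ((r / 2) ^ n * ((/ 2) ^ n * (/ 2) ^ n))))
      with ((Cmod (a n) * (r / 2) ^ n) * ((/ 2) ^ n * ((/ 2) ^ n * INR n))) by ring.
    apply Rmult_le_compat; [| |apply HM|].
    - apply Rmult_le_pos; [apply Cmod_ge_0 | apply pow_le; lra].
    - pose proof (pos_INR n). apply Rmult_le_pos; [lra|]. apply Rmult_le_pos; lra.
    - nra. }
  set (T := fun (n : nat) (p : C * C) => psum (fun k => a k * pow_quot (fst p - z) (snd p - z) k)%C n).
  set (D := fun p : C * C => Cmod (fst p - z) <= rho /\ Cmod (snd p - z) <= rho).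
  assert (He : is_lim_seq (fun n => M / rho / (1 - / 2) * (/ 2) ^ n) 0).
  { apply is_lim_seq_geom_scal; lra. }
  destruct (uniform_cauchy_lim D T _ He) as [Phi HPhi].
  { intros n m p [h1 h2] hnm. apply psum_geom_cauchy; auto; lra. }
  exists (fun w v => Phi (w, v)), rho. split; [exact hrho|].
  intros w v hw hv. split.
  - assert (L : lim_C (fun n => T n (w, v)) (Phi (w, v))).
    { apply (lim_C_of_bound _ _ (fun n => M / rho / (1 - / 2) * (/ 2) ^ n)); [|exact He].
      intros n. rewrite Cmod_minus_sym. apply HPhi. split; simpl; lra. }
    apply (lim_C_mult_l (w - v)%C) in L.
    assert (Hw := Hser (w - z)%C (Rlt_trans _ _ _ hw hrr)).
    assert (Hv := Hser (v - z)%C (Rlt_trans _ _ _ hv hrr)).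
    replace (z + (w - z))%C with w in Hw by ring.
    replace (z + (v - z))%C with v in Hv by ring.
    pose proof (lim_C_minus _ _ _ _ Hw Hv) as L'.
    replace (Phi (w, v) * (w - v))%C with (f w - f v)%C; [ring|].
    rewrite Cmult_comm.
    apply (lim_C_unique _ _ _ L').
    apply (fun E => lim_C_ext _ _ _ E L). intros n. unfold T.
    rewrite psum_minus, Cmult_comm, psum_mult_r. apply psum_ext. intros k _. simpl.
    replace (a k * (w - z) ^ k - a k * (v - z) ^ k)%C
      with (a k * ((w - z) ^ k - (v - z) ^ k))%C by ring.
    rewrite pow_quot_spec. ring.
  - apply (continuous_uniform_lim T _ _ _ He).
    + assert (N1 : @locally (prod_UniformSpace C_UniformSpace C_UniformSpace) (w, v)
        (fun p => Cmod (fst p - z) < rho /\ Cmod (snd p - z) < rho)).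
      { apply filter_and.
        - apply (continuous_fst (U := C_UniformSpace) (V := C_UniformSpace) w v
            (fun x => Cmod (x - z) < rho)).
          apply locally_Cmod_lt; assumption.
        - apply (continuous_snd (U := C_UniformSpace) (V := C_UniformSpace) w v
            (fun x => Cmod (x - z) < rho)).
          apply locally_Cmod_lt; assumption. }
      revert N1. apply filter_imp. intros p [h1 h2] n.
      rewrite <- surjective_pairing. apply HPhi. split; apply Rlt_le; assumption.
    + intros n. unfold T. apply (continuous_psum (fun k p => a k * pow_quot (fst p - z) (snd p - z) k)%C).
      intros k. apply continuous_Cmult; [apply continuous_Cconst|].
      assert (@continuous (prod_UniformSpace C_UniformSpace C_UniformSpace) C_UniformSpace
         fst (w, v)) by apply continuous_fst.
      assert (@continuous (prod_UniformSpace C_UniformSpace C_UniformSpace) C_UniformSpace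
         snd (w, v)) by apply continuous_snd.
      induction k; cbn [pow_quot]; [apply continuous_Cconst|]. ccont.
Qed.

Lemma analytic_at_C1 f z : analytic_at f z -> C1_at f z.
Proof.
  intros H. destruct (analytic_at_diff_quot f z H) as [Phi [d [hd HPhi]]].
  assert (Hdiag : forall w, @continuous C_UniformSpace
    (prod_UniformSpace C_UniformSpace C_UniformSpace) (fun x => (x, x)) w).
  { intros w P [e He]. exists e. intros x hx. apply He. split; exact hx. }
  assert (Hleft : forall w, @continuous C_UniformSpace
    (prod_UniformSpace C_UniformSpace C_UniformSpace) (fun x => (x, w)) w).
  { intros w P [e He]. exists e. intros x hx. apply He. split; [exact hx | apply ball_center]. }
  exists (fun w => Phi w w), d. split; [exact hd|]. intros w hw. split.
  - apply (cdiff_intro f (fun x => Phi x w) w (d - Cmod (w - z))); [lra| |].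
    + intros x hx. apply HPhi; [|exact hw]. pose proof (Cmod_triangle_minus x w z). lra.
    + apply (continuous_comp (fun x => (x, w)) (fun p => Phi (fst p) (snd p))); [apply Hleft|].
      apply HPhi; exact hw.
  - apply (continuous_comp (fun x => (x, x)) (fun p => Phi (fst p) (snd p))); [apply Hdiag|].
    apply HPhi; exact hw.
Qed.

(** * Cauchy's integral formula *)

Lemma continuous_cis {U : UniformSpace} (a : U -> R) x :
  @continuous U R_UniformSpace a x -> @continuous U C_UniformSpace (fun y => cis (a y)) x.
Proof.
  intros H. apply continuous_C; simpl.
  - apply (continuous_comp a cos); [exact H | apply continuous_cos].
  - apply (continuous_comp a sin); [exact H | apply continuous_sin].
Qed.

Lemma ccont_cis t : ccont cis t.
Proof. apply (continuous_cis (fun t => t)), continuous_id. Qed.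

Lemma ccont_bounded h a b : a <= b -> (forall t, a <= t <= b -> ccont h t) ->
  exists M, 0 <= M /\ forall t, a <= t <= b -> Cmod (h t) <= M.
Proof.
  intros hab H.
  destruct (continuity_ab_maj (fun t => Cmod (h t)) a b hab) as [m [Hm _]].
  - intros t ht eps he.
    destruct (proj1 (continuous_Cmod _ _) (H t ht) eps he) as [d Hd].
    exists d. split; [apply cond_pos|]. intros s [_ hs].
    eapply Rle_lt_trans; [|apply (Hd s hs)].
    apply Rabs_le. pose proof (Cmod_minus_le (h s) (h t)).
    pose proof (Cmod_minus_le (h t) (h s)). rewrite (Cmod_minus_sym (h t)) in H1. lra.
  - exists (Cmod (h m)). split; [apply Cmod_ge_0 | exact Hm].
Qed.

Lemma CInt_psum (F : nat -> R -> C) a b n : a <= b ->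
  (forall k t, a <= t <= b -> ccont (F k) t) ->
  CInt (fun t => psum (fun k => F k t) n) a b = psum (fun k => CInt (F k) a b) n.
Proof.
  intros hab H. induction n; simpl.
  - apply CInt_unique. evar_last; [apply (@is_RInt_const C_R_NormedModule)|].
    apply injective_projections; apply Rmult_0_r.
  - rewrite <- IHn. apply CInt_plus; auto. intros t ht.
    apply continuous_psum. intros k. apply H, ht.
Qed.

Lemma psum_geom x n : x <> RtoC 1 ->
  (psum (fun k => x ^ k) n = / (1 - x) - x ^ n * / (1 - x))%C.
Proof.
  intros hx. assert (1 - x <> 0)%C.
  { intros E. apply hx. replace x with (1 - (1 - x))%C by ring. rewrite E. ring. }
  induction n; simpl.
  - field; assumption.
  - rewrite IHn. field; assumption.
Qed.

Lemma one_minus_neq_0 (x : C) : Cmod x < 1 -> (1 - x <> 0)%C.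
Proof.
  intros h E. assert (x = RtoC 1).
  { replace x with (1 - (1 - x))%C by ring. rewrite E. ring. }
  subst. rewrite Cmod_1 in h. lra.
Qed.

Section Circle.
Variables (rho : R) (u : C).
Hypotheses (hrho : 0 < rho) (hu : Cmod u < rho).

Let zeta (t : R) : C := (RtoC rho * cis t)%C.

Lemma zeta_neq_0 t : zeta t <> RtoC 0.
Proof.
  apply Cmult_neq_0; [|apply cis_neq_0].
  intros E. apply (f_equal fst) in E. simpl in E. lra.
Qed.

Lemma Cmod_zeta t : Cmod (zeta t) = rho.
Proof. unfold zeta. rewrite Cmod_mult, Cmod_cis, Cmod_R, Rabs_pos_eq; lra. Qed.

Lemma ccont_zeta t : ccont zeta t.
Proof. apply continuous_Cmult; [apply continuous_Cconst | apply ccont_cis]. Qed.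

Lemma Cmod_ratio t : Cmod (u * / zeta t) = Cmod u / rho.
Proof. rewrite Cmod_mult, Cmod_inv, Cmod_zeta; [reflexivity | apply zeta_neq_0]. Qed.

Lemma ratio_lt_1 t : Cmod (u * / zeta t) < 1.
Proof.
  rewrite Cmod_ratio. apply Rmult_lt_reg_r with rho; [exact hrho|].
  unfold Rdiv. rewrite Rmult_assoc, Rinv_l; lra.
Qed.

(* [zeta / (zeta - u)]: the Cauchy kernel [zeta' / (zeta - u)] without the factor [i]. *)
Definition kernel (t : R) : C := (/ (1 - u * / zeta t))%C.

Lemma ccont_inv_zeta t : ccont (fun t => / zeta t)%C t.
Proof. apply continuous_Cinv; [apply zeta_neq_0 | apply ccont_zeta]. Qed.

Lemma ccont_kernel t : ccont kernel t.
Proof.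
  apply continuous_Cinv; [apply one_minus_neq_0, ratio_lt_1|].
  apply continuous_Cminus; [apply continuous_Cconst|].
  apply continuous_Cmult; [apply continuous_Cconst | apply ccont_inv_zeta].
Qed.

Lemma kernel_mult t : (kernel t * (zeta t - u) = zeta t)%C.
Proof.
  unfold kernel. pose proof (zeta_neq_0 t). pose proof (one_minus_neq_0 _ (ratio_lt_1 t)).
  assert (zeta t - u <> 0)%C.
  { intros E. apply H0. replace (1 - u * / zeta t)%C with ((zeta t - u) * / zeta t)%C
      by (field; assumption). rewrite E. ring. }
  field. split; assumption.
Qed.

(** Geometric expansion of [kernel] in [u / zeta t]: the remainder after [n] terms carries
    [(u / zeta t) ^ n], of modulus [q ^ n]. With [G] constantly 1 it evaluates the integral of the
    kernel; with the values of [f] on the circle it yields the power series of [f]. *)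
Lemma kernel_series (G : R -> C) : (forall t, ccont G t) ->
  lim_C (fun n => psum (fun k => CInt (fun t => G t * (/ zeta t) ^ k)%C 0 (2 * PI) * u ^ k)%C n)
    (CInt (fun t => kernel t * G t)%C 0 (2 * PI)).
Proof.
  intros HG. pose proof PI_RGT_0 as hpi.
  assert (h0 : 0 <= 2 * PI) by lra.
  destruct (ccont_bounded G 0 (2 * PI) h0 (fun t _ => HG t)) as [M [hM HM]].
  set (q := Cmod u / rho).
  assert (hq : 0 <= q < 1).
  { split; [apply Rdiv_le_0_compat; [apply Cmod_ge_0 | exact hrho]|].
    unfold q. rewrite <- (Cmod_ratio 0). apply ratio_lt_1. }
  assert (Hpow : forall k t, ccont (fun t => (/ zeta t) ^ k)%C t).
  { intros k t. apply continuous_Cpow, ccont_inv_zeta. }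
  apply (lim_C_of_bound _ _ (fun n => (2 * PI * (M / (1 - q))) * q ^ n));
    [|apply is_lim_seq_geom_scal, hq].
  intros n.
  assert (E : psum (fun k => CInt (fun t => G t * (/ zeta t) ^ k)%C 0 (2 * PI) * u ^ k)%C n
    = CInt (fun t => kernel t * G t - G t * ((u * / zeta t) ^ n * kernel t))%C 0 (2 * PI)).
  { transitivity (psum (fun k => CInt (fun t => u ^ k * (G t * (/ zeta t) ^ k))%C 0 (2 * PI)) n).
    - apply psum_ext. intros k _. rewrite CInt_scal; [ring | exact h0|].
      intros t _. apply continuous_Cmult; [apply HG | apply Hpow].
    - rewrite <- (CInt_psum (fun k t => u ^ k * (G t * (/ zeta t) ^ k))%C); [|exact h0|].
      + apply CInt_ext; [exact h0|]. intros t _.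
        transitivity (psum (fun k => (u * / zeta t) ^ k) n * G t)%C.
        * rewrite psum_mult_r. apply psum_ext. intros k _. rewrite Cpow_mult_l. ring.
        * rewrite psum_geom; [unfold kernel; ring|].
          intros E. pose proof (ratio_lt_1 t) as h. rewrite E, Cmod_1 in h. lra.
      + intros k t _. apply continuous_Cmult; [apply continuous_Cconst|].
        apply continuous_Cmult; [apply HG | apply Hpow]. }
  assert (C1 : forall t, ccont (fun t => kernel t * G t)%C t).
  { intros t. apply continuous_Cmult; [apply ccont_kernel | apply HG]. }
  assert (C2 : forall t, ccont (fun t => G t * ((u * / zeta t) ^ n * kernel t))%C t).
  { intros t. apply continuous_Cmult; [apply HG|].
    apply continuous_Cmult; [|apply ccont_kernel]. apply continuous_Cpow.
    apply continuous_Cmult; [apply continuous_Cconst | apply ccont_inv_zeta]. }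
  rewrite E, CInt_minus by auto.
  match goal with |- Cmod (?a - ?b - ?c) <= _ =>
    replace (a - b - c)%C with (- b)%C by ring end.
  rewrite Cmod_opp.
  eapply Rle_trans; [apply (CInt_bound _ _ _ (M * (q ^ n * / (1 - q)))); auto|].
  - intros t ht. rewrite !Cmod_mult, Cmod_pow, Cmod_ratio. fold q.
    apply Rmult_le_compat; [apply Cmod_ge_0 | | apply HM, ht |].
    + apply Rmult_le_pos; [apply pow_le, hq | apply Cmod_ge_0].
    + apply Rmult_le_compat_l; [apply pow_le, hq|].
      unfold kernel. rewrite Cmod_inv by apply one_minus_neq_0, ratio_lt_1.
      apply Rinv_le_contravar; [lra|].
      pose proof (Cmod_minus_le 1 (u * / zeta t)). rewrite Cmod_1, Cmod_ratio in H.
      exact H.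
  - right. field. lra.
Qed.

Lemma cis_inv_pow t k : ((/ cis t) ^ k = cis (- (INR k * t)))%C.
Proof.
  assert (H : forall a b, (cis a * cis b = cis (a + b))%C).
  { intros a b. unfold cis. rewrite cos_plus, sin_plus.
    apply injective_projections; simpl; ring. }
  assert (E0 : cis 0 = RtoC 1) by (unfold cis; rewrite cos_0, sin_0; reflexivity).
  assert (Hi : (/ cis t = cis (- t))%C).
  { pose proof (cis_neq_0 t) as hc.
    replace (cis (- t)) with (/ cis t * (cis t * cis (- t)))%C by (field; exact hc).
    rewrite H. replace (t + - t) with 0 by ring. rewrite E0. ring. }
  induction k.
  - replace (- (INR 0 * t)) with 0 by (simpl; ring). rewrite E0. reflexivity.
  - simpl Cpow. rewrite IHk, Hi, H, S_INR. f_equal. ring.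
Qed.

(** The factor 1 stands for the [G] of [kernel_series]. Up to a constant the integrand is
    [cis (- (m * t))] with [m = S k], which has a primitive of period [2 * PI] because [m] is a
    nonzero integer. *)
Lemma CInt_zeta_pow k : CInt (fun t => 1 * (/ zeta t) ^ S k)%C 0 (2 * PI) = RtoC 0.
Proof.
  pose proof PI_RGT_0 as hpi. assert (h0 : 0 <= 2 * PI) by lra.
  set (m := INR (S k)). assert (hm : m <> 0) by (apply not_0_INR; lia).
  assert (hr : RtoC rho <> 0%C) by (intros E; apply (f_equal fst) in E; simpl in E; lra).
  assert (E : CInt (fun t => cis (- (m * t))) 0 (2 * PI) = RtoC 0).
  { rewrite (CInt_derive (fun t => (RtoC (/ m) * (Ci * cis (- (m * t))))%C)); auto.
    - replace (cis (- (m * (2 * PI)))) with (cis (- (m * 0))); [ring|].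
      unfold m. rewrite <- !cis_inv_pow. now rewrite cis_2PI.
    - intros t _.
      replace (cis (- (m * t))) with
        (RtoC (/ m) * (Ci * (Ci * RtoC (- m) * cis (- (m * t)))))%C.
      2:{ replace (RtoC (/ m) * (Ci * (Ci * RtoC (- m) * cis (- (m * t)))))%C
          with (RtoC (/ m * m) * cis (- (m * t)))%C.
          - rewrite Rinv_l by exact hm. ring.
          - apply injective_projections; simpl; ring. }
      apply rdiff_mult_l, rdiff_mult_l.
      split; simpl; auto_derive; auto; ring.
    - intros t _. apply continuous_cis.
      apply (@ex_derive_continuous R_AbsRing R_NormedModule). auto_derive. exact I. }
  rewrite (CInt_ext _ (fun t => / RtoC rho ^ S k * cis (- (m * t)))%C); [|exact h0|].
  - rewrite CInt_scal, E; [ring | exact h0|].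
    intros t _. apply continuous_cis.
    apply (@ex_derive_continuous R_AbsRing R_NormedModule). auto_derive. exact I.
  - intros t _. unfold m. rewrite <- cis_inv_pow.
    rewrite <- Cpow_inv by exact hr. rewrite <- Cpow_mult_l.
    rewrite Cmult_1_l. f_equal. unfold zeta. field. split; [apply cis_neq_0 | exact hr].
Qed.

Lemma CInt_kernel : CInt kernel 0 (2 * PI) = RtoC (2 * PI).
Proof.
  pose proof PI_RGT_0 as hpi. assert (h0 : 0 <= 2 * PI) by lra.
  pose proof (kernel_series (fun _ => 1%C) (fun t => continuous_Cconst 1%C t)) as L.
  rewrite (CInt_ext _ kernel) in L; [|exact h0 | intros; ring].
  apply (lim_C_unique _ _ _ L). intros e he. exists 1%nat. intros [|n] hn; [lia|].
  rewrite psum_S_l.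
  rewrite (psum_ext _ (fun _ => RtoC 0)).
  2:{ intros k _. rewrite CInt_zeta_pow. ring. }
  rewrite psum_zero.
  rewrite (CInt_unique _ _ _ (RtoC (2 * PI))).
  - match goal with |- Cmod ?x < _ => replace x with (RtoC 0) by (simpl; ring) end.
    now rewrite Cmod_0.
  - apply (is_RInt_ext (V := C_R_NormedModule) (fun _ => RtoC 1)).
    + intros; simpl; ring.
    + evar_last; [apply (@is_RInt_const C_R_NormedModule)|].
      apply injective_projections; simpl; unfold scal; simpl; unfold mult; simpl; ring.
Qed.

Variables (f : C -> C) (c : C) (r : R).
Hypotheses (hr : rho < r) (Hf : forall z, Cmod (z - c) < r -> C1_at f z).

(* The homotopy contracting the circle to the point [c + u]. The integral of
   [kernel t * f (path s t)] does not depend on [s], since its integrand has an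
   [s]-derivative which is an exact [t]-derivative for [s > 0]. *)
Let path (s t : R) : C := (c + u + RtoC s * (zeta t - u))%C.
(* [path] remains in the domain of [f] a little beyond [0 <= s <= 1]. *)
Let margin := (r - rho) / (2 * rho).

Lemma margin_pos : 0 < margin.
Proof. apply Rdiv_lt_0_compat; lra. Qed.

(** [path s t - c] is [(1 - s) u + s zeta t]. Within [margin] of [[0, 1]] the absolute weights add
    up to less than [1 + 2 * margin], and [margin] is chosen to make this bound times [rho] equal to
    [r]. *)
Lemma path_in s t : - margin < s < 1 + margin -> Cmod (path s t - c) < r.
Proof.
  intros hs. unfold path.
  replace (c + u + s * (zeta t - u) - c)%C with (RtoC (1 - s) * u + RtoC s * zeta t)%C
    by (rewrite RtoC_minus; ring).
  eapply Rle_lt_trans; [apply Cmod_triangle|].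
  rewrite !Cmod_mult, !Cmod_R, Cmod_zeta.
  assert (Rabs (1 - s) + Rabs s < 1 + 2 * margin).
  { unfold Rabs; destruct (Rcase_abs (1 - s)); destruct (Rcase_abs s);
      pose proof margin_pos; lra. }
  assert ((1 + 2 * margin) * rho = r) by (unfold margin; field; lra).
  pose proof (Rabs_pos (1 - s)). pose proof (Cmod_ge_0 u). nra.
Qed.

(** Differentiation in [s] brings out [zeta t - u], which cancels the denominator of [kernel]. *)
Lemma rdiff_path_l s t : - margin < s < 1 + margin ->
  rdiff (fun s => kernel t * f (path s t))%C s (C_derive f (path s t) * zeta t)%C.
Proof.
  intros hs. rewrite <- (kernel_mult t).
  replace (C_derive f (path s t) * (kernel t * (zeta t - u)))%C with
    (kernel t * (C_derive f (path s t) * (zeta t - u)))%C by ring.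
  apply rdiff_mult_l, (cdiff_rdiff f (fun s => path s t)).
  - apply C1_at_C_derive, Hf, path_in, hs.
  - apply rdiff_affine.
Qed.

Lemma continuous_path s t :
  @continuous (prod_UniformSpace R_UniformSpace R_UniformSpace) C_UniformSpace
    (fun p => path (fst p) (snd p)) (s, t).
Proof.
  unfold path. ccont.
  - apply (continuous_fst (U := R_UniformSpace) (V := R_UniformSpace)).
  - apply continuous_Cmult; [apply continuous_Cconst|]. apply continuous_cis.
    apply (continuous_snd (U := R_UniformSpace) (V := R_UniformSpace)).
Qed.

Lemma ccont_path s t : ccont (path s) t.
Proof. unfold path. apply continuous_Cplus; ccont. apply ccont_zeta. Qed.

Lemma ccont_derive_path s t : - margin < s < 1 + margin ->
  ccont (fun t => C_derive f (path s t)) t.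
Proof.
  intros hs. apply (continuous_C_comp (path s) (C_derive f)); [apply ccont_path|].
  apply C1_at_C_derive, Hf, path_in, hs.
Qed.

Lemma ccont_f_path s t : - margin < s < 1 + margin -> ccont (fun t => f (path s t)) t.
Proof.
  intros hs. apply (continuous_C_comp (path s) f); [apply ccont_path|].
  apply C1_at_continuous, Hf, path_in, hs.
Qed.

(** [s i zeta t] is the [t]-derivative of [path s t]. Hence [s i] times the integrand is the
    derivative of [f (path s t)], which takes equal values at 0 and [2 * PI]; dividing by [s] uses
    [s > 0]. *)
Lemma CInt_derive_path s : 0 < s < 1 ->
  CInt (fun t => C_derive f (path s t) * zeta t)%C 0 (2 * PI) = RtoC 0.
Proof.
  intros hs. pose proof PI_RGT_0 as hpi. assert (h0 : 0 <= 2 * PI) by lra.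
  pose proof margin_pos as hm.
  assert (hs' : - margin < s < 1 + margin) by lra.
  assert (Cc : forall t, ccont (fun t => C_derive f (path s t) * zeta t)%C t).
  { intros t. apply continuous_Cmult; [now apply ccont_derive_path | apply ccont_zeta]. }
  assert (E : (RtoC s * Ci * CInt (fun t => C_derive f (path s t) * zeta t)%C 0 (2 * PI) = 0)%C).
  { rewrite <- CInt_scal; auto.
    rewrite (CInt_derive (fun t => f (path s t))); auto.
    - unfold path, zeta. rewrite cis_2PI. ring.
    - intros t _.
      replace (s * Ci * (C_derive f (path s t) * zeta t))%C with
        (C_derive f (path s t) * (s * (rho * (Ci * cis t))))%C by (unfold zeta; ring).
      apply (cdiff_rdiff f (path s)); [apply C1_at_C_derive, Hf, path_in, hs'|].
      unfold path. apply rdiff_plus_l, rdiff_mult_l.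
      apply rdiff_caratheodory.
      destruct (proj1 (rdiff_caratheodory _ _ _)
        (rdiff_mult_l rho cis t _ (rdiff_cis t))) as [psi [h1 [h2 h3]]].
      exists psi. repeat split; auto. intros x. unfold zeta. rewrite (h3 x). ring.
    - intros t _. apply continuous_Cmult; [apply continuous_Cconst | apply Cc]. }
  set (I0 := CInt _ _ _) in *.
  assert (hsc : RtoC s <> 0%C) by (intros X; apply (f_equal fst) in X; simpl in X; lra).
  replace I0 with ((/ RtoC s) * (- Ci) * (RtoC s * Ci * I0))%C.
  - rewrite E. ring.
  - replace (/ s * - Ci * (s * Ci * I0))%C with ((/ s * s) * - (Ci * Ci) * I0)%C by ring.
    rewrite Cinv_l by exact hsc.
    replace (Ci * Ci)%C with (RtoC (-1)) by (apply injective_projections; simpl; ring).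
    apply injective_projections; simpl; ring.
Qed.

(** Only real parts are compared because differentiation under the integral and the mean value
    theorem are used for real functions; [cauchy_formula] recovers the imaginary part. *)
Lemma homotopy_fst :
  fst (CInt (fun t => kernel t * f (path 1 t))%C 0 (2 * PI)) =
  fst (CInt (fun t => kernel t * f (path 0 t))%C 0 (2 * PI)).
Proof.
  pose proof PI_RGT_0 as hpi. assert (h0 : 0 <= 2 * PI) by lra.
  pose proof margin_pos as hm.
  set (F := fun s t => fst (kernel t * f (path s t))%C).
  assert (Hint : forall s, - margin < s < 1 + margin ->
    @is_RInt R_NormedModule (F s) 0 (2 * PI)
      (fst (CInt (fun t => kernel t * f (path s t))%C 0 (2 * PI)))).
  { intros s hs. apply is_RInt_fst, CInt_correct; auto. intros t _.
    apply continuous_Cmult; [apply ccont_kernel | now apply ccont_f_path]. }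
  assert (Hloc : forall s, - margin < s < 1 + margin ->
    @locally R_UniformSpace s (fun x => - margin < x < 1 + margin)).
  { intros s hs. apply (open_and (T := R_UniformSpace) _ _ (open_gt (- margin)) (open_lt (1 + margin))), hs. }
  assert (HDer : forall s t, - margin < s < 1 + margin ->
    Derive (fun x => F x t) s = fst (C_derive f (path s t) * zeta t)%C).
  { intros s t hs. exact (is_derive_unique _ _ _ (proj1 (rdiff_path_l s t hs))). }
  assert (Hd : forall s, - margin < s < 1 + margin ->
    is_derive (fun x => RInt (fun t => F x t) 0 (2 * PI)) s
      (RInt (fun t => Derive (fun x => F x t) s) 0 (2 * PI))).
  { intros s hs. apply is_derive_RInt_param.
    - generalize (Hloc s hs). apply filter_imp. intros x hx t _.
      eexists. exact (proj1 (rdiff_path_l x t hx)).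
    - intros t _. apply continuity_2d_pt_filterlim.
      pose (G := fun p : R * R => fst (C_derive f (path (fst p) (snd p)) * zeta (snd p))%C).
      change (@continuous (prod_UniformSpace R_UniformSpace R_UniformSpace) R_UniformSpace
        (fun p => Derive (fun x => F x (snd p)) (fst p)) (s, t)).
      apply (continuous_ext_loc _ G).
      + assert (N : @locally (prod_UniformSpace R_UniformSpace R_UniformSpace) (s, t)
          (fun p => - margin < fst p < 1 + margin))
          by exact (continuous_fst (U := R_UniformSpace) (V := R_UniformSpace) s t _ (Hloc s hs)).
        revert N. apply filter_imp. intros [x y] hx. symmetry. apply HDer. exact hx.
      + apply continuous_fst_C, continuous_Cmult.
        * apply (continuous_C_comp (fun p => path (fst p) (snd p)) (C_derive f)).
          -- apply continuous_path.
          -- apply C1_at_C_derive, Hf, path_in, hs.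
        * apply continuous_Cmult; [apply continuous_Cconst|]. apply continuous_cis.
          apply (continuous_snd (U := R_UniformSpace) (V := R_UniformSpace)).
    - generalize (Hloc s hs). apply filter_imp. intros x hx. eexists. apply Hint, hx. }
  assert (Hzero : forall s, 0 < s < 1 ->
    RInt (fun t => Derive (fun x => F x t) s) 0 (2 * PI) = 0).
  { intros s hs. assert (hs' : - margin < s < 1 + margin) by lra.
    rewrite (RInt_ext _ (fun t => fst (C_derive f (path s t) * zeta t)%C)).
    2:{ intros t _. apply HDer, hs'. }
    apply is_RInt_unique.
    change (@is_RInt R_NormedModule (fun t => fst (C_derive f (path s t) * zeta t)%C) 0 (2 * PI)
      (fst (RtoC 0))).
    rewrite <- (CInt_derive_path s hs).
    apply is_RInt_fst, CInt_correct; auto. intros t _.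
    apply continuous_Cmult; [now apply ccont_derive_path | apply ccont_zeta]. }
  rewrite <- (is_RInt_unique _ _ _ _ (Hint 1 ltac:(lra))).
  rewrite <- (is_RInt_unique _ _ _ _ (Hint 0 ltac:(lra))).
  (* [Hzero] covers the open interval. At the endpoints continuity is required, and [Hd] supplies it
     since [margin] lets it reach 0 and 1. *)
  destruct (MVT_gen (fun x => RInt (fun t => F x t) 0 (2 * PI)) 0 1 (fun _ => 0)) as [x [_ Hx]].
  - rewrite Rmin_left, Rmax_right by lra. intros x hx.
    pose proof (Hd x ltac:(lra)) as Hx. rewrite (Hzero x hx) in Hx. exact Hx.
  - rewrite Rmin_left, Rmax_right by lra. intros x hx.
    apply continuity_pt_filterlim.
    apply (@ex_derive_continuous R_AbsRing R_NormedModule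
      (fun x => RInt (fun t => F x t) 0 (2 * PI))).
    eexists. apply (Hd x). lra.
  - change (RInt (F 1) 0 (2 * PI) - RInt (F 0) 0 (2 * PI) = 0 * (1 - 0)) in Hx. lra.
Qed.

End Circle.

Lemma cauchy_formula f c r rho u :
  0 < rho < r -> Cmod u < rho ->
  (forall z, Cmod (z - c) < r -> C1_at f z) ->
  (CInt (fun t => kernel rho u t * f (c + RtoC rho * cis t))%C 0 (2 * PI) =
   RtoC (2 * PI) * f (c + u))%C.
Proof.
  intros [hrho hr] hu Hf.
  pose proof PI_RGT_0 as hpi. assert (h0 : 0 <= 2 * PI) by lra.
  assert (Cc : forall t, ccont (fun t => kernel rho u t * f (c + RtoC rho * cis t))%C t).
  { intros t. apply continuous_Cmult; [now apply ccont_kernel|].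
    apply (continuous_C_comp (fun t => c + RtoC rho * cis t)%C f).
    - apply continuous_Cplus; ccont. apply ccont_cis.
    - apply C1_at_continuous, Hf.
      replace (c + rho * cis t - c)%C with (RtoC rho * cis t)%C by ring.
      rewrite Cmod_zeta; assumption. }
  assert (Hend : forall h, (forall z, Cmod (z - c) < r -> C1_at h z) ->
    fst (CInt (fun t => kernel rho u t * h (c + RtoC rho * cis t))%C 0 (2 * PI)) =
    fst (RtoC (2 * PI) * h (c + u))%C).
  { intros h Hh. pose proof (homotopy_fst rho u hrho hu h c r hr Hh) as E.
    rewrite (CInt_ext _ (fun t => kernel rho u t * h (c + RtoC rho * cis t))%C) in E; auto.
    2:{ intros t _. do 2 f_equal. ring. }
    (* At [s = 0] the path is constantly [c + u], so [h (c + u)] leaves the integral and only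
       [CInt_kernel] remains. *)
    rewrite E. f_equal.
    rewrite (CInt_ext _ (fun t => h (c + u) * kernel rho u t)%C); auto.
    2:{ intros t _. rewrite Cmult_comm. do 2 f_equal. ring. }
    rewrite CInt_scal; auto using ccont_kernel.
    rewrite CInt_kernel by assumption. ring. }
  apply injective_projections; [now apply Hend|].
  (* The imaginary part of [w] is the real part of [- Ci * w]. *)
  specialize (Hend (fun z => - Ci * f z)%C).
  rewrite (CInt_ext _ (fun t => - Ci * (kernel rho u t * f (c + RtoC rho * cis t)))%C) in Hend; auto.
  2:{ intros t _. ring. }
  rewrite CInt_scal in Hend; auto.
  assert (X : forall z : C, snd z = fst (- Ci * z)%C) by (intros z; simpl; ring).
  rewrite !X, Hend.
  - f_equal. ring.
  - intros z hz. apply C1_at_mult; [apply C1_at_const | now apply Hf].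
Qed.

(** Cauchy's formula is a hypothesis here, instead of [C1_at], so that the lemma also applies to a
    uniform limit, for which differentiability is not yet known. *)
Lemma cauchy_analytic f c rho : 0 < rho ->
  (forall t, ccont (fun t => f (c + RtoC rho * cis t)%C) t) ->
  (forall u, Cmod u < rho ->
    (CInt (fun t => kernel rho u t * f (c + RtoC rho * cis t))%C 0 (2 * PI) =
     RtoC (2 * PI) * f (c + u))%C) ->
  analytic_at f c.
Proof.
  intros hrho Hc Hf. pose proof PI_RGT_0 as hpi.
  assert (hne : RtoC (2 * PI) <> 0%C) by (intros E; apply (f_equal fst) in E; simpl in E; lra).
  exists (fun k => / RtoC (2 * PI) *
    CInt (fun t => f (c + RtoC rho * cis t) * (/ (RtoC rho * cis t)) ^ k) 0 (2 * PI))%C,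
    (mkposreal rho hrho).
  intros w hw. simpl in hw. apply is_pseries_lim_C.
  pose proof (kernel_series rho (w - c)%C hrho hw _ Hc) as L.
  cbv beta in L. rewrite (Hf (w - c)%C hw) in L. apply (lim_C_mult_l (/ RtoC (2 * PI))%C) in L.
  replace (/ RtoC (2 * PI) * (RtoC (2 * PI) * f (c + (w - c))))%C with (f w) in L.
  - refine (lim_C_ext _ _ _ _ L). intros n. rewrite Cmult_comm, psum_mult_r.
    apply psum_ext. intros k _. ring.
  - replace (c + (w - c))%C with w by ring. field. exact hne.
Qed.

Lemma C1_at_analytic f z : C1_at f z -> analytic_at f z.
Proof.
  intros Hz.
  assert (H : exists r, 0 < r /\ forall w, Cmod (w - z) < r -> C1_at f w).
  { destruct Hz as [f1 [d [hd H]]]. exists d. split; [exact hd|]. intros w hw.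
    exists f1, (d - Cmod (w - z)). split; [lra|]. intros v hv. apply H.
    pose proof (Cmod_triangle_minus v w z). lra. }
  destruct H as [r [hr Hr]].
  assert (h2 : 0 < r / 2 < r) by lra.
  apply (cauchy_analytic f z (r / 2)); [lra | |].
  - intros t. apply (continuous_C_comp (fun t => z + RtoC (r / 2) * cis t)%C f).
    + apply continuous_Cplus; ccont. apply ccont_cis.
    + apply C1_at_continuous, Hr.
      replace (z + RtoC (r / 2) * cis t - z)%C with (RtoC (r / 2) * cis t)%C by ring.
      rewrite Cmod_zeta; lra.
  - intros u hu. now apply (cauchy_formula f z r).
Qed.

Lemma analytic_at_iff_C1 f z : analytic_at f z <-> C1_at f z.
Proof. split; [apply analytic_at_C1 | apply C1_at_analytic]. Qed.

(** For fixed [u] the kernel is bounded on the circle, so Cauchy's formula for the [S n] passes to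
    the uniform limit [F], and [cauchy_analytic] concludes. *)
Lemma weierstrass (S : nat -> C -> C) (F : C -> C) (e : nat -> R) (z : C) r :
  0 < r -> is_lim_seq e 0 ->
  (forall n w, Cmod (w - z) < r -> analytic_at (S n) w) ->
  (forall n w, Cmod (w - z) < r -> Cmod (F w - S n w) <= e n) ->
  analytic_at F z.
Proof.
  intros hr He HS HF. set (rho := r / 2). assert (hrho : 0 < rho < r) by (unfold rho; lra).
  pose proof PI_RGT_0 as hpi. assert (h0 : 0 <= 2 * PI) by lra.
  assert (Hcirc : forall t, Cmod (z + RtoC rho * cis t - z) < r).
  { intros t. replace (z + RtoC rho * cis t - z)%C with (RtoC rho * cis t)%C by ring.
    rewrite Cmod_zeta; lra. }
  assert (Ccirc : forall t, ccont (fun t => z + RtoC rho * cis t)%C t).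
  { intros t. apply continuous_Cplus; ccont. apply ccont_cis. }
  assert (CS : forall n t, ccont (fun t => S n (z + RtoC rho * cis t)%C) t).
  { intros n t. apply (continuous_C_comp (fun t => z + RtoC rho * cis t)%C (S n)); [apply Ccirc|].
    apply C1_at_continuous, analytic_at_C1, HS, Hcirc. }
  assert (CF : forall t, ccont (fun t => F (z + RtoC rho * cis t)%C) t).
  { intros t. apply (continuous_uniform_lim (fun n t => S n (z + RtoC rho * cis t)%C) _ e).
    - exact He.
    - apply filter_forall. intros s n. apply HF, Hcirc.
    - intros n. apply CS. }
  apply (cauchy_analytic F z rho); [lra | exact CF |].
  intros u hu.
  destruct (ccont_bounded (kernel rho u) 0 (2 * PI) h0) as [M [hM HM]].
  { intros t _. now apply ccont_kernel. }
  assert (CKS : forall n t, ccont (fun t => kernel rho u t * S n (z + RtoC rho * cis t))%C t).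
  { intros n t. apply continuous_Cmult; [now apply ccont_kernel | apply CS]. }
  assert (CKF : forall t, ccont (fun t => kernel rho u t * F (z + RtoC rho * cis t))%C t).
  { intros t. apply continuous_Cmult; [now apply ccont_kernel | apply CF]. }
  apply (lim_C_unique (fun n => RtoC (2 * PI) * S n (z + u)%C)%C).
  - apply (lim_C_of_bound _ _ (fun n => 2 * PI * M * e n)).
    + intros n. rewrite <- (cauchy_formula (S n) z r rho u hrho hu).
      2:{ intros w hw. apply analytic_at_C1, HS, hw. }
      rewrite <- (CInt_minus _ _ _ _ h0 (fun t _ => CKS n t) (fun t _ => CKF t)).
      eapply Rle_trans; [apply (CInt_bound _ _ _ (M * e n)); [exact h0| |]|].
      * intros t _. apply continuous_Cminus; [apply CKS | apply CKF].
      * intros t ht.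
        match goal with |- Cmod (?k * ?a - ?k * ?b) <= _ =>
          replace (k * a - k * b)%C with (k * - (b - a))%C by ring end.
        rewrite Cmod_mult, Cmod_opp.
        apply Rmult_le_compat; auto using Cmod_ge_0.
      * right; ring.
    + replace (Finite 0) with (Rbar_mult (2 * PI * M) 0) by (simpl; f_equal; ring).
      now apply is_lim_seq_scal_l.
  - apply lim_C_mult_l. apply (lim_C_of_bound _ _ e); [|exact He].
    intros n. rewrite Cmod_minus_sym. apply HF.
    replace (z + u - z)%C with u by ring. lra.
Qed.

(** * Analytic functions on the disc *)

Lemma analytic_at_ext_loc f h z d : 0 < d ->
  (forall w, Cmod (w - z) < d -> f w = h w) -> analytic_at f z -> analytic_at h z.
Proof.
  intros hd E [a [r Hr]].
  assert (hm : 0 < Rmin r d) by (apply Rmin_pos; [apply cond_pos | exact hd]).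
  exists a, (mkposreal _ hm). intros w hw; simpl in hw.
  rewrite <- E by (eapply Rlt_le_trans; [exact hw | apply Rmin_r]).
  apply Hr. eapply Rlt_le_trans; [exact hw | apply Rmin_l].
Qed.

Lemma disc_nbhd (z w : C) : disc z -> Cmod (w - z) < 1 - Cmod z -> disc w.
Proof.
  unfold disc. intros hz hw. pose proof (Cmod_minus_le w z). lra.
Qed.

Lemma HD_ext f h : (forall z, disc z -> f z = h z) -> HD f -> HD h.
Proof.
  intros E H z hz. apply (analytic_at_ext_loc f h z (1 - Cmod z)).
  - unfold disc in hz. lra.
  - intros w hw. apply E, (disc_nbhd z); assumption.
  - apply H, hz.
Qed.

Lemma HD_C1 f : HD f <-> forall z, disc z -> C1_at f z.
Proof. split; intros H z hz; apply analytic_at_iff_C1, H, hz. Qed.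

Lemma HD_continuous f z : HD f -> disc z -> @continuous C_UniformSpace C_UniformSpace f z.
Proof. intros H hz. apply C1_at_continuous, HD_C1; assumption. Qed.

Lemma HD_derive_continuous g z : HD g -> disc z ->
  @continuous C_UniformSpace C_UniformSpace (C_derive g) z.
Proof. intros H hz. apply C1_at_C_derive, HD_C1; assumption. Qed.

Lemma HD_const c : HD (fun _ => c).
Proof. apply HD_C1. intros z _. apply C1_at_const. Qed.

Lemma HD_plus f h : HD f -> HD h -> HD (fun z => f z + h z)%C.
Proof. rewrite !HD_C1. intros Hf Hh z hz. apply C1_at_plus; auto. Qed.

Lemma HD_mult f h : HD f -> HD h -> HD (fun z => f z * h z)%C.
Proof. rewrite !HD_C1. intros Hf Hh z hz. apply C1_at_mult; auto. Qed.

Lemma HD_pow n : HD (fun z => z ^ n)%C.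
Proof. apply HD_C1. intros z _. apply C1_at_pow. Qed.

Lemma HD_dilation f (r : R) : 0 < r < 1 -> HD f -> HD (fun z => f (RtoC r * z))%C.
Proof.
  intros hr Hf z hz.
  assert (hrz : disc (RtoC r * z)).
  { unfold disc in *. rewrite Cmod_mult, Cmod_R, Rabs_pos_eq by lra.
    pose proof (Cmod_ge_0 z). nra. }
  destruct (Hf _ hrz) as [a [d Hd]].
  exists (fun k => a k * RtoC r ^ k)%C, d. intros w hw.
  assert (E : (RtoC r * w - RtoC r * z = RtoC r * (w - z))%C) by ring.
  assert (hw' : Cmod (RtoC r * w - RtoC r * z) < d).
  { rewrite E, Cmod_mult, Cmod_R, Rabs_pos_eq by lra. pose proof (Cmod_ge_0 (w - z)). nra. }
  specialize (Hd _ hw'). rewrite E in Hd. apply is_pseries_lim_C in Hd.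
  apply is_pseries_lim_C. refine (lim_C_ext _ _ _ _ Hd). intros n.
  apply psum_ext. intros k _. rewrite Cpow_mult_l. ring.
Qed.

(** * The disc algebra *)

(** Stated for any filter because [continuous_on] at a boundary point uses [within], not the full
    neighbourhood filter of [continuous]. *)
Lemma filterlim_C_plus {T : Type} (F : (T -> Prop) -> Prop) {FF : Filter F}
    (f h : T -> C) (a b : C) :
  filterlim f F (@locally C_UniformSpace a) -> filterlim h F (@locally C_UniformSpace b) ->
  filterlim (fun x => f x + h x)%C F (@locally C_UniformSpace (a + b)%C).
Proof.
  intros Hf Hh. apply filterlim_Cmod; [exact FF|]. intros e he.
  assert (h2 : 0 < e / 2) by lra.
  generalize (filter_and _ _ (proj1 (filterlim_Cmod F f a) Hf (e / 2) h2)
    (proj1 (filterlim_Cmod F h b) Hh (e / 2) h2)).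
  apply filter_imp. intros x [H1 H2].
  replace (f x + h x - (a + b))%C with ((f x - a) + (h x - b))%C by ring.
  eapply Rle_lt_trans; [apply Cmod_triangle|]. lra.
Qed.

Lemma filterlim_C_mult {T : Type} (F : (T -> Prop) -> Prop) {FF : Filter F}
    (f h : T -> C) (a b : C) :
  filterlim f F (@locally C_UniformSpace a) -> filterlim h F (@locally C_UniformSpace b) ->
  filterlim (fun x => f x * h x)%C F (@locally C_UniformSpace (a * b)%C).
Proof.
  intros Hf Hh. apply filterlim_Cmod; [exact FF|]. intros e he.
  pose proof (Cmod_ge_0 a) as ha. pose proof (Cmod_ge_0 b) as hb.
  (* The product deviates by less than [d * (d + Cmod a + Cmod b)]; [d <= 1] makes this linear in
     [d]. *)
  set (d := Rmin 1 (e / (1 + Cmod a + Cmod b))).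
  assert (hd : 0 < d) by (apply Rmin_pos; [lra | apply Rdiv_lt_0_compat; lra]).
  assert (hd1 : d <= 1) by apply Rmin_l.
  assert (hde : d * (1 + Cmod a + Cmod b) <= e).
  { assert (h0 : d <= e / (1 + Cmod a + Cmod b)) by apply Rmin_r.
    apply Rmult_le_compat_r with (r := 1 + Cmod a + Cmod b) in h0; [|lra].
    unfold Rdiv in h0. rewrite Rmult_assoc, Rinv_l, Rmult_1_r in h0; lra. }
  generalize (filter_and _ _ (proj1 (filterlim_Cmod F f a) Hf d hd)
    (proj1 (filterlim_Cmod F h b) Hh d hd)).
  apply filter_imp. intros x [H1 H2].
  replace (f x * h x - a * b)%C with ((f x - a) * (h x - b) + (a * (h x - b) + b * (f x - a)))%C by ring.
  eapply Rle_lt_trans; [apply Cmod_triangle|].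
  eapply Rle_lt_trans; [apply Rplus_le_compat_l, Cmod_triangle|]. rewrite !Cmod_mult.
  pose proof (Cmod_ge_0 (f x - a)). pose proof (Cmod_ge_0 (h x - b)). nra.
Qed.

Lemma continuous_on_of_continuous (D : C -> Prop) F :
  (forall z, D z -> @continuous C_UniformSpace C_UniformSpace F z) -> continuous_on D F.
Proof.
  intros H z hz P HP. destruct (H z hz P HP) as [d Hd]. exists d. intros w hw _. now apply Hd.
Qed.

Lemma continuous_on_plus D F G : continuous_on D F -> continuous_on D G ->
  continuous_on D (fun z => F z + G z)%C.
Proof.
  intros HF HG z hz. apply filterlim_C_plus; [apply within_filter, locally_filter | |]; auto.
Qed.

Lemma continuous_on_mult D F G : continuous_on D F -> continuous_on D G ->
  continuous_on D (fun z => F z * G z)%C.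
Proof.
  intros HF HG z hz. apply filterlim_C_mult; [apply within_filter, locally_filter | |]; auto.
Qed.

Lemma continuous_on_Cmod D F : continuous_on D F <->
  forall z, D z -> forall eps, 0 < eps -> exists d, 0 < d /\
    forall w, D w -> Cmod (w - z) < d -> Cmod (F w - F z) < eps.
Proof.
  assert (W : forall z : C, Filter (within D (@locally C_UniformSpace z)))
    by (intros z; apply within_filter, locally_filter).
  unfold continuous_on. split; intros H z hz.
  - intros e he.
    pose proof (proj1 (filterlim_Cmod (within D (@locally C_UniformSpace z)) F (F z)) (H z hz) e he) as K.
    unfold within in K. apply locally_Cmod in K.
    destruct K as [d [hd K]]. exists d. split; auto.
  - apply (filterlim_Cmod (within D (@locally C_UniformSpace z))).
    intros e he. destruct (H z hz e he) as [d [hd Hd]].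
    unfold within. apply locally_Cmod. exists d. split; auto.
Qed.

Lemma disc_closed z : disc z -> closed_disc z.
Proof. unfold disc, closed_disc. lra. Qed.

Lemma disc_dense z d : closed_disc z -> 0 < d -> exists w, disc w /\ Cmod (w - z) < d.
Proof.
  unfold closed_disc, disc. intros hz hd.
  set (s := Rmin (1 / 2) (d / 2)).
  assert (hs : 0 < s) by (apply Rmin_pos; lra).
  assert (hs1 : s <= 1 / 2) by apply Rmin_l. assert (hs2 : s <= d / 2) by apply Rmin_r.
  pose proof (Cmod_ge_0 z).
  exists (RtoC (1 - s) * z)%C. split.
  - rewrite Cmod_mult, Cmod_R, Rabs_pos_eq by lra. nra.
  - replace (RtoC (1 - s) * z - z)%C with (RtoC (- s) * z)%C
      by (rewrite RtoC_minus, RtoC_opp; ring).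
    rewrite Cmod_mult, Cmod_R, Rabs_Ropp, Rabs_pos_eq by lra. nra.
Qed.

(** Carries sup-norm estimates on the disc over to continuous extensions, by density. *)
Lemma Cmod_le_closed_disc F B : continuous_on closed_disc F ->
  (forall z, disc z -> Cmod (F z) <= B) -> forall z, closed_disc z -> Cmod (F z) <= B.
Proof.
  intros HF HB z hz. apply le_epsilon; intros e he.
  destruct (proj1 (continuous_on_Cmod _ _) HF z hz e he) as [d [hd Hd]].
  destruct (disc_dense z d hz hd) as [w [hw hwz]].
  specialize (Hd w (disc_closed _ hw) hwz). specialize (HB w hw).
  pose proof (Cmod_minus_le (F z) (F w)) as K. rewrite Cmod_minus_sym in K. lra.
Qed.

Lemma disc_algebra_ext f h :
  (forall z, disc z -> f z = h z) -> disc_algebra f -> disc_algebra h.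
Proof.
  intros E [Hf [F [HF HFf]]]. split; [now apply (HD_ext f)|].
  exists F. split; [exact HF|]. intros z hz. rewrite <- E; auto.
Qed.

Lemma disc_algebra_of_continuous f : HD f ->
  (forall z, closed_disc z -> @continuous C_UniformSpace C_UniformSpace f z) ->
  disc_algebra f.
Proof.
  intros Hf Hc. split; [exact Hf|]. exists f. split; [|reflexivity].
  apply continuous_on_of_continuous, Hc.
Qed.

Lemma disc_algebra_plus f h : disc_algebra f -> disc_algebra h ->
  disc_algebra (fun z => f z + h z)%C.
Proof.
  intros [Hf [F [CF EF]]] [Hh [H [CH EH]]]. split; [now apply HD_plus|].
  exists (fun z => F z + H z)%C. split; [now apply continuous_on_plus|].
  intros z hz. now rewrite EF, EH.
Qed.

Lemma disc_algebra_mult f h : disc_algebra f -> disc_algebra h ->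
  disc_algebra (fun z => f z * h z)%C.
Proof.
  intros [Hf [F [CF EF]]] [Hh [H [CH EH]]]. split; [now apply HD_mult|].
  exists (fun z => F z * H z)%C. split; [now apply continuous_on_mult|].
  intros z hz. now rewrite EF, EH.
Qed.

Lemma disc_algebra_const c : disc_algebra (fun _ => c).
Proof.
  apply disc_algebra_of_continuous; [apply HD_const|]. intros; apply continuous_const.
Qed.

Lemma disc_algebra_pow n : disc_algebra (fun z => z ^ n)%C.
Proof.
  apply disc_algebra_of_continuous; [apply HD_pow|].
  intros z _. apply continuous_Cpow, continuous_Cid.
Qed.

Lemma disc_algebra_dilation f (r : R) : 0 < r < 1 -> HD f ->
  disc_algebra (fun z => f (RtoC r * z))%C.
Proof.
  intros hr Hf. apply disc_algebra_of_continuous; [now apply HD_dilation|].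
  intros z hz. apply (continuous_C_comp (fun z => RtoC r * z)%C f); [ccont|].
  apply HD_continuous; [exact Hf|]. unfold disc, closed_disc in *.
  rewrite Cmod_mult, Cmod_R, Rabs_pos_eq by lra. pose proof (Cmod_ge_0 z). nra.
Qed.

(** Completeness of the disc algebra. Inside, this is [weierstrass]; for the boundary values, the
    extensions of the [S n] are uniformly Cauchy on the closed disc by [Cmod_le_closed_disc], and
    their limit extends [F]. *)
Lemma disc_algebra_uniform_lim (S : nat -> C -> C) F (e : nat -> R) :
  (forall n, disc_algebra (S n)) -> is_lim_seq e 0 ->
  (forall n m, (n <= m)%nat -> e m <= e n) ->
  (forall n z, disc z -> Cmod (F z - S n z) <= e n) -> disc_algebra F.
Proof.
  intros HS He Hmono HF. split.
  - intros z hz. apply (weierstrass S F e z (1 - Cmod z)).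
    + unfold disc in hz; lra.
    + exact He.
    + intros n w hw. apply (HS n), (disc_nbhd z); assumption.
    + intros n w hw. apply HF, (disc_nbhd z); assumption.
  - pose (G := fun n => proj1_sig (constructive_indefinite_description _ (proj2 (HS n)))).
    assert (HG : forall n, continuous_on closed_disc (G n) /\ forall z, disc z -> G n z = S n z).
    { intros n. exact (proj2_sig (constructive_indefinite_description _ (proj2 (HS n)))). }
    (* [S m] and [S n] differ by at most [e n + e m], and [e m <= e n] when [n <= m]. *)
    assert (He2 : is_lim_seq (fun n => 2 * e n) 0).
    { replace (Finite 0) with (Rbar_mult 2 0) by (simpl; f_equal; ring).
      now apply is_lim_seq_scal_l. }
    destruct (uniform_cauchy_lim closed_disc G _ He2) as [H HH].
    { intros n m z hz hnm.
      replace (G m z - G n z)%C with (G m z + (RtoC (-1)) * G n z)%C by ring.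
      apply (Cmod_le_closed_disc (fun z => G m z + (RtoC (-1)) * G n z)%C); [| |exact hz].
      - apply continuous_on_plus; [apply HG|].
        apply (continuous_on_mult _ (fun _ => RtoC (-1))); [|apply HG].
        apply continuous_on_of_continuous. intros; apply continuous_const.
      - intros w hw. rewrite (proj2 (HG m) w hw), (proj2 (HG n) w hw).
        replace (S m w + (RtoC (-1)) * S n w)%C with ((F w - S n w) - (F w - S m w))%C by ring.
        eapply Rle_trans; [apply Cmod_triangle|]. rewrite Cmod_opp.
        pose proof (HF n w hw). pose proof (HF m w hw). specialize (Hmono n m hnm). lra. }
    exists H. split.
    + apply continuous_on_Cmod. intros z hz eps heps.
      apply is_lim_seq_spec in He2. assert (h3 : 0 < eps / 3) by lra.
      destruct (He2 (mkposreal _ h3)) as [N HN]. specialize (HN N ltac:(lia)).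
      simpl in HN. rewrite Rminus_0_r in HN. apply Rabs_def2 in HN.
      destruct (proj1 (continuous_on_Cmod _ _) (proj1 (HG N)) z hz _ h3) as [d [hd Hd]].
      exists d. split; [exact hd|]. intros w hw hwz. specialize (Hd w hw hwz).
      pose proof (HH N z hz). pose proof (HH N w hw).
      replace (H w - H z)%C with ((H w - G N w) + (G N w - G N z) - (H z - G N z))%C by ring.
      eapply Rle_lt_trans; [apply Cmod_triangle|]. rewrite Cmod_opp.
      eapply Rle_lt_trans; [apply Rplus_le_compat_r, Cmod_triangle|]. lra.
    + intros z hz. apply (lim_C_unique (fun n => S n z)).
      * apply (lim_C_of_bound _ _ (fun n => 2 * e n)); [|exact He2]. intros n.
        rewrite Cmod_minus_sym, <- (proj2 (HG n) z hz). apply HH, disc_closed, hz.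
      * apply (lim_C_of_bound _ _ e); [|exact He]. intros n.
        rewrite Cmod_minus_sym. apply HF, hz.
Qed.

(** * The Volterra operator *)

Lemma disc_segment z t : disc z -> 0 <= t <= 1 -> disc (RtoC t * z).
Proof.
  unfold disc. intros hz ht. rewrite Cmod_mult, Cmod_R, Rabs_pos_eq by lra.
  pose proof (Cmod_ge_0 z). nra.
Qed.

Lemma ccont_segment f z t :
  @continuous C_UniformSpace C_UniformSpace f (RtoC t * z)%C ->
  ccont (fun t => f (RtoC t * z)%C) t.
Proof.
  intros H. apply (continuous_C_comp (fun t => RtoC t * z)%C f); [|exact H]. ccont.
Qed.

Lemma Vop_CInt g f z :
  Vop g f z = CInt (fun t => f (RtoC t * z) * C_derive g (RtoC t * z) * z)%C 0 1.
Proof.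
  apply CInt_ext; [lra|]. intros t _.
  replace (0 + RtoC t * (z - 0))%C with (RtoC t * z)%C by ring. ring.
Qed.

Lemma ccont_Vop g f z t : HD g -> HD f -> disc z -> 0 <= t <= 1 ->
  ccont (fun t => f (RtoC t * z) * C_derive g (RtoC t * z) * z)%C t.
Proof.
  intros Hg Hf hz ht. pose proof (disc_segment z t hz ht).
  apply continuous_Cmult; [|apply continuous_Cconst].
  apply (ccont_segment (fun w => f w * C_derive g w)%C).
  apply continuous_Cmult; [now apply HD_continuous | now apply HD_derive_continuous].
Qed.

Lemma Vop_at_0 g f : Vop g f 0%C = RtoC 0.
Proof.
  rewrite Vop_CInt. apply CInt_unique.
  apply (is_RInt_ext (V := C_R_NormedModule) (fun _ => RtoC 0)).
  { intros t _. change (RtoC 0 = f (RtoC t * 0) * C_derive g (RtoC t * 0) * 0)%C. ring. }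
  evar_last; [apply (@is_RInt_const C_R_NormedModule)|].
  apply injective_projections; simpl; apply Rmult_0_r.
Qed.

Lemma Vop_plus g f h z : HD g -> HD f -> HD h -> disc z ->
  Vop g (fun w => f w + h w)%C z = (Vop g f z + Vop g h z)%C.
Proof.
  intros Hg Hf Hh hz. rewrite !Vop_CInt.
  rewrite <- (CInt_plus _ _ _ _ Rle_0_1 (fun t => ccont_Vop g f z t Hg Hf hz)
    (fun t => ccont_Vop g h z t Hg Hh hz)).
  apply CInt_ext; [lra|]. intros t _. ring.
Qed.

Lemma Vop_scal g f c z : HD g -> HD f -> disc z ->
  Vop g (fun w => c * f w)%C z = (c * Vop g f z)%C.
Proof.
  intros Hg Hf hz. rewrite !Vop_CInt.
  rewrite <- (CInt_scal _ _ _ _ Rle_0_1 (fun t => ccont_Vop g f z t Hg Hf hz)).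
  apply CInt_ext; [lra|]. intros t _. ring.
Qed.

Lemma Vop_zero g z : HD g -> disc z -> Vop g (fun _ => RtoC 0) z = RtoC 0.
Proof.
  intros Hg hz. transitivity (RtoC 0 * Vop g (fun _ => RtoC 0) z)%C; [|ring].
  rewrite <- Vop_scal; auto using HD_const. rewrite !Vop_CInt.
  apply CInt_ext; [lra|]. intros; ring.
Qed.

Lemma Vop_psum g (F : nat -> C -> C) n z : HD g -> (forall k, HD (F k)) -> disc z ->
  Vop g (fun w => psum (fun k => F k w) n) z = psum (fun k => Vop g (F k) z) n.
Proof.
  intros Hg HF hz.
  assert (HP : forall n, HD (fun w => psum (fun k => F k w) n)).
  { intros m. induction m; simpl; [apply HD_const | now apply HD_plus]. }
  induction n; simpl; [now apply Vop_zero|].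
  rewrite Vop_plus by auto. now rewrite IHn.
Qed.

(** Uniform convergence on the segment from 0 to [z] suffices, since [C_derive g] is bounded there.
    The bound depends on [z], so the convergence obtained is pointwise. *)
Lemma Vop_lim g (S : nat -> C -> C) f z :
  HD g -> (forall n, HD (S n)) -> HD f -> disc z ->
  (forall eps, 0 < eps -> exists N, forall n t, (N <= n)%nat -> 0 <= t <= 1 ->
     Cmod (S n (RtoC t * z)%C - f (RtoC t * z)%C) <= eps) ->
  lim_C (fun n => Vop g (S n) z) (Vop g f z).
Proof.
  intros Hg HS Hf hz H.
  destruct (ccont_bounded (fun t => C_derive g (RtoC t * z) * z)%C 0 1) as [M [hM HM]]; [lra| |].
  { intros t ht. apply continuous_Cmult; [|apply continuous_Cconst].
    apply ccont_segment, HD_derive_continuous; [exact Hg | now apply disc_segment]. }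
  intros eps heps.
  destruct (H (eps / (M + 1))) as [N HN]; [apply Rdiv_lt_0_compat; lra|].
  exists N. intros n hn. rewrite !Vop_CInt.
  rewrite <- (CInt_minus _ _ _ _ Rle_0_1 (fun t => ccont_Vop g (S n) z t Hg (HS n) hz)
    (fun t => ccont_Vop g f z t Hg Hf hz)).
  apply Rle_lt_trans with ((1 - 0) * (eps / (M + 1) * M)).
  - apply CInt_bound; [lra| |].
    + intros t ht. apply continuous_Cminus.
      * exact (ccont_Vop g (S n) z t Hg (HS n) hz ht).
      * exact (ccont_Vop g f z t Hg Hf hz ht).
    + intros t ht.
      match goal with |- Cmod (?a * ?b * ?c - ?d * ?b * ?c) <= _ =>
        replace (a * b * c - d * b * c)%C with ((a - d) * (b * c))%C by ring end.
      rewrite Cmod_mult. apply Rmult_le_compat; auto using Cmod_ge_0.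
  - replace ((1 - 0) * (eps / (M + 1) * M)) with (eps - eps / (M + 1)) by (field; lra).
    assert (0 < eps / (M + 1)) by (apply Rdiv_lt_0_compat; lra). lra.
Qed.

(** * The optimal domain *)

Lemma compact_cluster {T : UniformSpace} (K : T -> Prop) (u : nat -> T) :
  compact_set K -> (forall n, K (u n)) ->
  exists x, K x /\ forall (eps : posreal) N, exists n, (N <= n)%nat /\ ball x eps (u n).
Proof.
  intros HK Hu. apply NNPP. intros Hno.
  assert (H : forall x, K x -> exists (eps : posreal) N,
    forall n, (N <= n)%nat -> ~ ball x eps (u n)).
  { intros x hx. apply NNPP. intros Hx. apply Hno. exists x. split; [exact hx|].
    intros eps N. apply NNPP. intros Hn. apply Hx. exists eps, N. intros n hn hb.
    apply Hn. exists n. auto. }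
  (* An index is a point, a radius and a rank from which the sequence avoids that ball. Balls of a
     uniform space need not be open, hence the interiors [locally y (ball ..)]. For a rank [N]
     beyond those of a finite subcover, [u N] lies in none of its balls. *)
  destruct (HK {p : T * posreal * nat | forall n, (snd p <= n)%nat ->
      ~ ball (fst (fst p)) (snd (fst p)) (u n)}
    (fun i y => locally y (ball (fst (fst (proj1_sig i))) (snd (fst (proj1_sig i))))))
    as [l Hl].
  - intros i y hy. apply locally_locally, hy.
  - intros x hx. destruct (H x hx) as [eps [N HN]].
    exists (exist _ ((x, eps), N) HN). apply locally_ball.
  - assert (B : exists N, forall i, In i l -> (snd (proj1_sig i) <= N)%nat).
    { clear Hl. induction l as [|i l [N HN]]; [exists O; intros i []|].
      exists (max N (snd (proj1_sig i))). intros j [<-|hj]; [lia|].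
      specialize (HN j hj). lia. }
    destruct B as [N HN]. destruct (Hl (u N) (Hu N)) as [i [hi Hi]].
    apply (proj2_sig i N (HN i hi)). apply (locally_singleton _ _ Hi).
Qed.

(** The subsequence is expressed by arbitrarily large indices. The cluster point comes from the disc
    algebra because [compact_operator] takes the closure inside [X], and pointwise convergence
    forces it to agree with [h] on the disc. *)
Lemma compact_operator_cluster (T : (C -> C) -> C -> C) (f : nat -> C -> C) (h : C -> C) :
  compact_operator disc_algebra T ->
  (forall n, disc_algebra (f n)) ->
  (forall n z, disc z -> Cmod (f n z) <= 1) ->
  (forall z, disc z -> lim_C (fun n => T (f n) z) (h z)) ->
  disc_algebra h /\
  forall eps, 0 < eps -> forall N, exists n, (N <= n)%nat /\
    forall z, disc z -> Cmod (T (f n) z - h z) <= eps.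
Proof.
  intros [HT HK] Hf Hb Hlim.
  destruct (compact_cluster _ (fun n => restrict (T (f n))) HK) as [x [[[k [Hk ->]] _] Hx]].
  { intros n. split.
    - exists (T (f n)). split; [apply HT, Hf | reflexivity].
    - intros eps. exists (restrict (T (f n))). split; [|apply ball_center].
      exists (f n). auto. }
  assert (Hclose : forall eps, 0 < eps -> forall N, exists n, (N <= n)%nat /\
    forall z, disc z -> Cmod (T (f n) z - k z) <= eps).
  { intros eps heps N. assert (h2 : 0 < eps / 2) by lra.
    destruct (Hx (mkposreal _ h2) N) as [n [hn Hn]]. exists n. split; [exact hn|].
    intros z hz. specialize (Hn (exist _ z hz)). apply Cmod_ball_C in Hn.
    unfold restrict in Hn. simpl in Hn. simpl. lra. }
  assert (E : forall z, disc z -> k z = h z).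
  { intros z hz. apply eq_of_Cmod_le. intros e he.
    assert (h2 : 0 < e / 2) by lra.
    destruct (Hlim z hz (e / 2) h2) as [N HN].
    destruct (Hclose (e / 2) h2 N) as [n [hn Hn]].
    specialize (HN n hn). specialize (Hn z hz).
    pose proof (Cmod_triangle_minus (k z) (T (f n) z) (h z)) as K.
    rewrite (Cmod_minus_sym (k z) (T (f n) z)) in K. lra. }
  split; [now apply (disc_algebra_ext k)|].
  intros eps heps N. destruct (Hclose eps heps N) as [n [hn Hn]]. exists n.
  split; [exact hn|]. intros z hz. rewrite <- E; auto.
Qed.

(** A dilated point of the segment is again on it, with parameter [r * t]; uniform continuity of
    [f (t z)] in [t] on [[0, 1]] then gives a [d] valid for all [t]. *)
Lemma dilation_uniform_segment f z : HD f -> disc z -> forall eps, 0 < eps ->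
  exists d, 0 < d /\ forall r t, 1 - d < r <= 1 -> 0 <= r -> 0 <= t <= 1 ->
    Cmod (f (RtoC r * (RtoC t * z))%C - f (RtoC t * z)%C) <= eps.
Proof.
  intros Hf hz eps heps.
  destruct (unifcont_normed_1d (K := R_AbsRing) (V := C_R_NormedModule)
    (fun t => f (RtoC t * z)%C) 0 1) with (eps := mkposreal eps heps) as [d Hd].
  { intros t ht. apply ccont_segment, HD_continuous; [exact Hf | now apply disc_segment]. }
  exists d. split; [apply cond_pos|]. intros r t hr hr0 ht.
  replace (RtoC r * (RtoC t * z))%C with (RtoC (r * t) * z)%C by (rewrite RtoC_mult; ring).
  left. specialize (Hd t (r * t) ht).
  assert (h1 : 0 <= r * t <= 1) by (split; nra).
  specialize (Hd h1). unfold ball_norm in Hd. rewrite Cmod_norm. apply Hd.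
  change (Rabs (r * t - t) < d). apply Rabs_def1; nra.
Qed.

(** * An unbounded analytic sum of monomials *)

Lemma bernoulli_below_1 P x : 0 <= 1 - x -> 0 <= x -> 1 - INR P * (1 - x) <= x ^ P.
Proof.
  intros h1 h2. induction P; [simpl; lra|]. rewrite S_INR. simpl.
  apply (Rmult_le_compat_l x) in IHP; [|exact h2].
  pose proof (Rmult_le_pos _ _ (pos_INR P) (pow2_ge_0 (1 - x))). nra.
Qed.

(** [k <= m k] bounds the terms by [Cmod z ^ k], hence convergence with the stated tail. The sum is
    unbounded because at a real [x] close to 1 any prescribed number of terms are at least 1/2,
    while the others are nonnegative. *)
Lemma lacunary_sum (m : nat -> nat) : (forall k, (k <= m k)%nat) ->
  exists F : C -> C, HD F /\ ~ HInf F /\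
    forall n z, disc z ->
      Cmod (F z - psum (fun k => z ^ m k)%C n) <= / (1 - Cmod z) * Cmod z ^ n.
Proof.
  intros hm.
  assert (Hterm : forall q z, 0 <= q < 1 -> Cmod z <= q -> forall k,
    Cmod (z ^ m k)%C <= 1 * q ^ k).
  { intros q z hq hz k. rewrite Cmod_pow, Rmult_1_l.
    apply Rle_trans with (q ^ m k); [apply pow_incr; split; [apply Cmod_ge_0 | exact hz]|].
    specialize (hm k). replace (m k) with (k + (m k - k))%nat by lia. rewrite pow_add.
    pose proof (pow_le q k (proj1 hq)). assert (q ^ (m k - k) <= 1).
    { rewrite <- (pow1 (m k - k)). apply pow_incr. lra. }
    nra. }
  (* The premise [disc z] sits under the existential so that choosing [l] defines a total
     function. *)
  assert (Hex : forall z, exists l, disc z ->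
    forall n, Cmod (l - psum (fun k => z ^ m k)%C n) <= / (1 - Cmod z) * Cmod z ^ n).
  { intros z. destruct (classic (disc z)) as [hz|hz]; [|exists 0%C; tauto].
    assert (hq : 0 <= Cmod z < 1) by (split; [apply Cmod_ge_0 | exact hz]).
    destruct (uniform_cauchy_lim (fun _ : unit => True)
      (fun n _ => psum (fun k => z ^ m k)%C n) _ (is_lim_seq_geom_scal (1 / (1 - Cmod z)) _ hq))
      as [l Hl].
    { intros n k _ _ hnk. apply psum_geom_cauchy; auto. apply Hterm; [exact hq | lra]. }
    exists (l tt). intros _ n. rewrite <- Rdiv_1_l. apply (Hl n tt I). }
  pose (F := fun z => proj1_sig (constructive_indefinite_description _ (Hex z))).
  assert (HF : forall n z, disc z ->
    Cmod (F z - psum (fun k => z ^ m k)%C n) <= / (1 - Cmod z) * Cmod z ^ n).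
  { intros n z hz. exact (proj2_sig (constructive_indefinite_description _ (Hex z)) hz n). }
  clearbody F. exists F. split; [|split; [|exact HF]].
  (* [q] is the midpoint of [Cmod z] and 1, so every point within [(1 - Cmod z) / 2] of [z] has
     modulus at most [q] and one tail bound serves them all. *)
  - intros z hz. set (q := (1 + Cmod z) / 2). unfold disc in hz.
    pose proof (Cmod_ge_0 z) as hz0.
    assert (hq : 0 <= q < 1) by (unfold q; lra).
    apply (weierstrass (fun n w => psum (fun k => w ^ m k)%C n) F (fun n => / (1 - q) * q ^ n)
      z ((1 - Cmod z) / 2)); [lra | now apply is_lim_seq_geom_scal | |].
    + intros n w _. apply C1_at_analytic.
      induction n; simpl; [apply C1_at_const|]. apply C1_at_plus; [exact IHn | apply C1_at_pow].
    + intros n w hw. pose proof (Cmod_minus_le w z).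
      assert (hwq : Cmod w <= q) by (unfold q; lra).
      eapply Rle_trans; [apply HF; unfold disc; lra|].
      pose proof (Cmod_ge_0 w).
      apply Rmult_le_compat.
      * left. apply Rinv_0_lt_compat. lra.
      * apply pow_le, Cmod_ge_0.
      * apply Rinv_le_contravar; lra.
      * apply pow_incr. lra.
  - intros [_ [M HM]].
    assert (hM : 0 <= M).
    { specialize (HM 0%C). unfold disc in HM. rewrite Cmod_0 in HM.
      pose proof (Cmod_ge_0 (F 0%C)). specialize (HM Rlt_0_1). lra. }
    (* [N] terms of size at least 1/2 exceed [M + 1]; the extra 1 pays for replacing [F] by a
       partial sum. *)
    destruct (nfloor_ex (2 * (M + 1)) ltac:(lra)) as [N0 HN0]. set (N := S N0).
    assert (HN : 2 * (M + 1) < INR N) by (unfold N; rewrite S_INR; lra).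
    assert (HP : exists P, forall k, (k < N)%nat -> (m k <= P)%nat).
    { clear HN. generalize N. intros K. induction K as [|K [P IH]]; [exists O; intros; lia|].
      exists (max P (m K)). intros k hk. destruct (Nat.eq_dec k K) as [->|]; [lia|].
      specialize (IH k ltac:(lia)). lia. }
    destruct HP as [P HP].
    (* Chosen so that Bernoulli's inequality gives [x ^ P >= 1/2]; the [+ 1] covers [P = 0]. *)
    set (x := 1 - / (2 * (INR P + 1))).
    pose proof (pos_INR P) as hP.
    assert (hx1 : 0 < / (2 * (INR P + 1))) by (apply Rinv_0_lt_compat; lra).
    assert (hx2 : / (2 * (INR P + 1)) <= / 2) by (apply Rinv_le_contravar; lra).
    assert (hx : 0 < x < 1) by (unfold x; lra).
    assert (hxP : / 2 <= x ^ P).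
    { eapply Rle_trans; [|apply bernoulli_below_1; lra]. unfold x.
      replace (1 - (1 - / (2 * (INR P + 1)))) with (/ (2 * (INR P + 1))) by ring.
      replace (INR P * / (2 * (INR P + 1))) with (/ 2 - / (2 * (INR P + 1))) by (field; lra).
      lra. }
    assert (Hfst : forall k, fst (RtoC x ^ m k)%C = x ^ m k).
    { intros k. rewrite <- RtoC_pow. reflexivity. }
    assert (Hlow : forall n, (n <= N)%nat -> INR n / 2 <= fst (psum (fun k => RtoC x ^ m k)%C n)).
    { induction n; intros hn; [simpl; lra|].
      rewrite S_INR. change (fst (psum (fun k => RtoC x ^ m k)%C (S n)))
        with (fst (psum (fun k => RtoC x ^ m k)%C n) + fst (RtoC x ^ m n)%C).
      rewrite Hfst. specialize (IHn ltac:(lia)).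
      assert (x ^ P <= x ^ m n).
      { specialize (HP n ltac:(lia)). replace P with (m n + (P - m n))%nat by lia.
        rewrite pow_add. pose proof (pow_le x (m n) ltac:(lra)).
        assert (x ^ (P - m n) <= 1) by (rewrite <- (pow1 (P - m n)); apply pow_incr; lra). nra. }
      lra. }
    assert (Hmono : forall j, fst (psum (fun k => RtoC x ^ m k)%C N) <=
      fst (psum (fun k => RtoC x ^ m k)%C (j + N))).
    { induction j; [simpl; lra|]. eapply Rle_trans; [exact IHj|].
      change (fst (psum (fun k => RtoC x ^ m k)%C (S j + N)))
        with (fst (psum (fun k => RtoC x ^ m k)%C (j + N)) + fst (RtoC x ^ m (j + N)%nat)%C).
      rewrite Hfst. pose proof (pow_le x (m (j + N)%nat) ltac:(lra)). lra. }
    assert (hcx : Cmod (RtoC x) = x) by (rewrite Cmod_R, Rabs_pos_eq; lra).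
    assert (hdx : disc (RtoC x)) by (unfold disc; rewrite hcx; lra).
    assert (hxl : 0 <= x < 1) by lra.
    pose proof (is_lim_seq_geom_scal (/ (1 - x)) x hxl) as L. apply is_lim_seq_spec in L.
    destruct (L (mkposreal 1 Rlt_0_1)) as [K HK].
    (* The index is at least [K], so the tail is below 1, and at least [N], so the large terms are
       included. *)
    specialize (HK (K + N)%nat ltac:(lia)). simpl in HK. rewrite Rminus_0_r in HK.
    apply Rabs_def2 in HK.
    pose proof (HF (K + N)%nat _ hdx) as HB. rewrite hcx in HB.
    specialize (HM _ hdx). specialize (Hlow N ltac:(lia)). specialize (Hmono K).
    set (s := psum _ (K + N)) in *.
    pose proof (Cmod_minus_le s (F (RtoC x))). rewrite Cmod_minus_sym in H.
    pose proof (fst_le_Cmod s). pose proof (Rle_abs (fst s)). lra.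
Qed.

(** * Consequences of the compactness of [Vop g] *)

Section Volterra.
Variable g : C -> C.
Hypotheses (hg : HD g) (hV : compact_operator disc_algebra (Vop g)).

Lemma HInf_Vop f : HInf f -> disc_algebra (Vop g f).
Proof.
  intros [Hf [M HM]].
  assert (hM : 0 <= M).
  { specialize (HM 0%C). unfold disc in HM. rewrite Cmod_0 in HM.
    pose proof (Cmod_ge_0 (f 0%C)). specialize (HM Rlt_0_1). lra. }
  (* Scales the dilations into the unit ball; [M + 1] is nonzero even when [M = 0]. *)
  set (c := RtoC (/ (M + 1))).
  assert (hc : Cmod c = / (M + 1)).
  { unfold c. rewrite Cmod_R, Rabs_pos_eq; [reflexivity|]. left. apply Rinv_0_lt_compat. lra. }
  (* The shift by 2 keeps [r n] strictly between 0 and 1 already at [n = 0]. *)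
  set (r := fun n : nat => 1 - / (INR n + 2)).
  assert (hr : forall n, 0 < r n < 1).
  { intros n. pose proof (pos_INR n). unfold r.
    assert (0 < / (INR n + 2)) by (apply Rinv_0_lt_compat; lra).
    assert (/ (INR n + 2) <= / 2) by (apply Rinv_le_contravar; lra). lra. }
  set (fn := fun n z => (c * f (RtoC (r n) * z))%C).
  assert (Hfn : forall n, disc_algebra (fn n)).
  { intros n. apply (disc_algebra_mult (fun _ => c)); [apply disc_algebra_const|].
    now apply disc_algebra_dilation. }
  assert (HL : forall z, disc z -> lim_C (fun n => Vop g (fn n) z) (c * Vop g f z)%C).
  { intros z hz. rewrite <- Vop_scal by assumption.
    apply Vop_lim; auto.
    - intros n. apply Hfn.
    - apply HD_mult; [apply HD_const | exact Hf].
    - intros eps heps.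
      destruct (dilation_uniform_segment f z Hf hz eps heps) as [d [hd Hd]].
      destruct (nfloor_ex (/ d)) as [N HN]; [left; now apply Rinv_0_lt_compat|].
      exists N. intros n t hn ht. unfold fn.
      match goal with |- Cmod (c * ?a - c * ?b) <= _ =>
        replace (c * a - c * b)%C with (c * (a - b))%C by ring end.
      rewrite Cmod_mult, hc.
      assert (Hd' : Cmod (f (RtoC (r n) * (RtoC t * z))%C - f (RtoC t * z)%C) <= eps).
      { specialize (hr n). apply Hd; [|lra | exact ht]. split; [|lra]. unfold r.
        assert (/ (INR n + 2) < d); [|lra].
        rewrite <- (Rinv_inv d). apply le_INR in hn.
        assert (0 < / d) by now apply Rinv_0_lt_compat.
        apply Rinv_lt_contravar; [|lra]. apply Rmult_lt_0_compat; lra. }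
      assert (/ (M + 1) <= 1) by (rewrite <- Rinv_1; apply Rinv_le_contravar; lra).
      assert (0 < / (M + 1)) by (apply Rinv_0_lt_compat; lra).
      pose proof (Cmod_ge_0 (f (RtoC (r n) * (RtoC t * z))%C - f (RtoC t * z)%C)).
      nra. }
  destruct (compact_operator_cluster (Vop g) fn (fun z => c * Vop g f z)%C hV Hfn) as [HA _].
  - intros n z hz. unfold fn. rewrite Cmod_mult, hc.
    assert (Cmod (f (RtoC (r n) * z)%C) <= M).
    { apply HM, disc_segment; [exact hz|]. specialize (hr n). lra. }
    apply Rmult_le_reg_l with (M + 1); [lra|].
    rewrite <- Rmult_assoc, Rinv_r, Rmult_1_l by lra. lra.
  - exact HL.
  - apply (disc_algebra_ext (fun z => RtoC (M + 1) * (c * Vop g f z))%C).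
    + intros z _. unfold c. rewrite Cmult_assoc, <- RtoC_mult, Rinv_r by lra. ring.
    + apply (disc_algebra_mult (fun _ => RtoC (M + 1))); [apply disc_algebra_const | exact HA].
Qed.

(** The monomials lie in the unit ball and tend to 0 uniformly on each segment from 0, so their
    images tend to 0 at each point of the disc. *)
Lemma Vop_pow_small eps : 0 < eps -> forall N, exists n, (N <= n)%nat /\
  forall z, disc z -> Cmod (Vop g (fun w => w ^ n)%C z) <= eps.
Proof.
  intros heps N.
  destruct (compact_operator_cluster (Vop g) (fun n w => w ^ n)%C (fun _ => RtoC 0) hV)
    as [_ H].
  - intros n. apply disc_algebra_pow.
  - intros n z hz. rewrite Cmod_pow, <- (pow1 n). apply pow_incr.
    unfold disc in hz. pose proof (Cmod_ge_0 z). lra.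
  - intros z hz. rewrite <- (Vop_zero g z hg hz). apply Vop_lim; auto using HD_const.
    + intros n. apply HD_pow.
    + intros e he.
      assert (hq : 0 <= Cmod z < 1) by (split; [apply Cmod_ge_0 | exact hz]).
      pose proof (is_lim_seq_geom_scal 1 (Cmod z) hq) as L. apply is_lim_seq_spec in L.
      destruct (L (mkposreal e he)) as [K HK]. exists K. intros n t hn ht.
      specialize (HK n hn). simpl in HK. rewrite Rminus_0_r in HK. apply Rabs_def2 in HK.
      replace ((RtoC t * z) ^ n - 0)%C with ((RtoC t * z) ^ n)%C by ring.
      rewrite Cmod_pow, Cmod_mult, Cmod_R, Rabs_pos_eq by lra.
      apply Rle_trans with (Cmod z ^ n); [|lra]. apply pow_incr. nra.
  - destruct (H eps heps N) as [n [hn Hn]]. exists n. split; [exact hn|].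
    intros z hz. replace (Vop g (fun w => w ^ n) z)%C with (Vop g (fun w => w ^ n) z - 0)%C by ring.
    exact (Hn z hz).
Qed.

Lemma unbounded_optimal : exists f, optimal_domain (Vop g) disc_algebra f /\ ~ HInf f.
Proof.
  assert (hpos : forall k, 0 < (/ 2) ^ k) by (intros; apply pow_lt; lra).
  pose (m := fun k => proj1_sig (constructive_indefinite_description _
    (Vop_pow_small ((/ 2) ^ k) (hpos k) k))).
  assert (Hm : forall k, (k <= m k)%nat /\
    forall z, disc z -> Cmod (Vop g (fun w => w ^ m k)%C z) <= (/ 2) ^ k).
  { intros k. exact (proj2_sig (constructive_indefinite_description _
      (Vop_pow_small ((/ 2) ^ k) (hpos k) k))). }
  clearbody m.
  destruct (lacunary_sum m (fun k => proj1 (Hm k))) as [F [HF [HnF HS]]].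
  exists F. split; [split; [exact HF|] | exact HnF].
  assert (he : is_lim_seq (fun n => 1 / (1 - / 2) * (/ 2) ^ n) 0) by (apply is_lim_seq_geom_scal; lra).
  assert (HDS : forall n, disc_algebra (fun w => psum (fun k => w ^ m k)%C n)).
  { intros n. induction n; simpl; [apply disc_algebra_const|].
    apply disc_algebra_plus; [exact IHn | apply disc_algebra_pow]. }
  assert (Hcauchy : forall n k z, disc z -> (n <= k)%nat ->
    Cmod (Vop g (fun w => psum (fun k => w ^ m k)%C k) z -
          Vop g (fun w => psum (fun k => w ^ m k)%C n) z) <= 1 / (1 - / 2) * (/ 2) ^ n).
  { intros n k z hz hnk.
    rewrite !(Vop_psum g (fun k w => w ^ m k)%C) by (auto; intros; apply HD_pow).
    apply psum_geom_cauchy; [lra | | exact hnk]. intros j. rewrite Rmult_1_l. now apply Hm. }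
  apply (disc_algebra_uniform_lim (fun n => Vop g (fun w => psum (fun k => w ^ m k)%C n)) _
    (fun n => 1 / (1 - / 2) * (/ 2) ^ n)).
  - intros n. apply (proj1 hV), HDS.
  - exact he.
  - intros n k hnk. apply Rmult_le_compat_l; [lra|].
    replace k with (n + (k - n))%nat by lia. rewrite pow_add.
    pose proof (hpos n). assert ((/ 2) ^ (k - n) <= 1).
    { rewrite <- (pow1 (k - n)). apply pow_incr. lra. } nra.
  - intros n z hz.
    (* [Hcauchy] gives uniform convergence to some limit; this pointwise statement identifies it as
       [Vop g F]. The tail bound of [lacunary_sum] increases with the modulus, so along the segment
       its value at [z] is the worst. *)
    assert (L : lim_C (fun n => Vop g (fun w => psum (fun k => w ^ m k)%C n) z) (Vop g F z)).
    { apply Vop_lim; auto.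
      - intros k. apply HDS.
      - intros eps heps.
        assert (hq : 0 <= Cmod z < 1) by (split; [apply Cmod_ge_0 | exact hz]).
        pose proof (is_lim_seq_geom_scal (/ (1 - Cmod z)) _ hq) as L. apply is_lim_seq_spec in L.
        destruct (L (mkposreal eps heps)) as [N HN]. exists N. intros k t hk ht.
        specialize (HN k hk). simpl in HN. rewrite Rminus_0_r in HN. apply Rabs_def2 in HN.
        rewrite Cmod_minus_sym. eapply Rle_trans; [apply HS, disc_segment; assumption|].
        assert (hle : Cmod (RtoC t * z) <= Cmod z).
        { rewrite Cmod_mult, Cmod_R, Rabs_pos_eq by lra. nra. }
        eapply Rle_trans; [|left; apply (proj1 HN)].
        apply Rmult_le_compat.
        + left. apply Rinv_0_lt_compat. lra.
        + apply pow_le, Cmod_ge_0.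
        + apply Rinv_le_contravar; lra.
        + apply pow_incr. split; [apply Cmod_ge_0 | exact hle]. }
    (* Let [k] grow in [Hcauchy] with [n] fixed. *)
    apply (lim_C_Cmod_le _ _ _ (lim_C_minus_const _ _ (Vop g (fun w => psum (fun k => w ^ m k)%C n) z) L)).
    exists n. intros k hk. now apply Hcauchy.
Qed.

End Volterra.

(** * Division by [z]: from [Vop] to [Top] *)

Lemma Top_nonzero g f z : z <> RtoC 0 -> Top g f z = (/ z * Vop g f z)%C.
Proof. intros hz. unfold Top. destruct (Ceq_dec z 0) as [E|_]; [now elim hz | reflexivity]. Qed.

Lemma Top_zero g f : Top g f 0%C = (f 0 * C_derive g 0)%C.
Proof. unfold Top. destruct (Ceq_dec 0 0) as [_|n]; [reflexivity | now elim n]. Qed.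

Lemma Vop_Top g f z : Vop g f z = (z * Top g f z)%C.
Proof.
  destruct (Ceq_dec z 0) as [->|hz].
  - rewrite Vop_at_0. ring.
  - rewrite Top_nonzero by exact hz. field. exact hz.
Qed.

(** For [w <> 0], [/ w * Vop g f w] is the mean of [f * C_derive g] over the segment from 0 to [w],
    hence close to the value at 0, which is how [Top] is defined there. *)
Lemma Top_continuous_at_0 g f : HD g -> HD f ->
  @continuous C_UniformSpace C_UniformSpace (Top g f) (RtoC 0).
Proof.
  intros Hg Hf. assert (h0 : disc 0%C) by (unfold disc; rewrite Cmod_0; lra).
  set (h := fun w => (f w * C_derive g w)%C).
  assert (Ch : @continuous C_UniformSpace C_UniformSpace h (RtoC 0)).
  { apply continuous_Cmult; [now apply HD_continuous | now apply HD_derive_continuous]. }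
  apply continuous_Cmod. intros eps heps. apply locally_Cmod.
  assert (h2 : 0 < eps / 2) by lra.
  destruct (proj1 (locally_Cmod _ _) (proj1 (continuous_Cmod _ _) Ch _ h2)) as [d [hd Hd]].
  exists (Rmin d 1). split; [apply Rmin_pos; lra|]. intros w hw.
  replace (w - 0)%C with w in hw by ring.
  pose proof (Rmin_l d 1). pose proof (Rmin_r d 1).
  assert (hdw : disc w) by (unfold disc; lra).
  destruct (Ceq_dec w 0) as [->|hw0].
  { replace (Top g f 0 - Top g f 0)%C with (RtoC 0) by ring. now rewrite Cmod_0. }
  rewrite Top_zero, Top_nonzero by exact hw0. fold (h 0%C).
  assert (Cs : forall t, 0 <= t <= 1 -> ccont (fun t => h (RtoC t * w)%C) t).
  { intros t ht. apply ccont_segment. pose proof (disc_segment w t hdw ht).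
    apply continuous_Cmult; [now apply HD_continuous | now apply HD_derive_continuous]. }
  assert (E : (/ w * Vop g f w - h 0 = CInt (fun t => h (RtoC t * w) - h 0) 0 1)%C).
  { rewrite (CInt_minus _ (fun _ => h 0%C) _ _ Rle_0_1 Cs)
      by (intros; apply continuous_const).
    f_equal.
    - rewrite Vop_CInt, (CInt_ext _ (fun t => w * h (RtoC t * w))%C).
      + rewrite (CInt_scal _ _ _ _ Rle_0_1 Cs). field. exact hw0.
      + exact Rle_0_1.
      + intros t _. unfold h. ring.
    - f_equal. symmetry. apply CInt_unique.
      evar_last; [apply (@is_RInt_const C_R_NormedModule)|].
      apply injective_projections; simpl; unfold scal; simpl; unfold mult; simpl; ring. }
  rewrite E. apply Rle_lt_trans with ((1 - 0) * (eps / 2)); [|lra].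
  apply CInt_bound; [exact Rle_0_1 | |].
  - intros t ht. apply continuous_Cminus; [now apply Cs | apply continuous_const].
  - intros t ht. left. apply Hd. replace (RtoC t * w - 0)%C with (RtoC t * w)%C by ring.
    rewrite Cmod_mult, Cmod_R, Rabs_pos_eq by lra. pose proof (Cmod_ge_0 w). nra.
Qed.

Lemma continuous_eq_punctured (f h : C -> C) z d : 0 < d ->
  @continuous C_UniformSpace C_UniformSpace f z ->
  @continuous C_UniformSpace C_UniformSpace h z ->
  (forall w, w <> z -> Cmod (w - z) < d -> f w = h w) -> f z = h z.
Proof.
  intros hd Cf Ch E. apply eq_of_Cmod_le. intros e he. assert (h2 : 0 < e / 2) by lra.
  destruct (proj1 (locally_Cmod _ _) (proj1 (continuous_Cmod _ _) Cf _ h2)) as [a [ha Ha]].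
  destruct (proj1 (locally_Cmod _ _) (proj1 (continuous_Cmod _ _) Ch _ h2)) as [b [hb Hb]].
  set (s := Rmin d (Rmin a b) / 2).
  assert (hs : 0 < Rmin d (Rmin a b)) by (repeat apply Rmin_pos; assumption).
  pose proof (Rmin_l d (Rmin a b)). pose proof (Rmin_r d (Rmin a b)).
  pose proof (Rmin_l a b). pose proof (Rmin_r a b).
  assert (hw : Cmod (z + RtoC s - z) = s).
  { replace (z + RtoC s - z)%C with (RtoC s) by ring.
    rewrite Cmod_R, Rabs_pos_eq; [reflexivity | unfold s; lra]. }
  assert (hne : (z + RtoC s)%C <> z).
  { intros X. rewrite X in hw. replace (z - z)%C with (RtoC 0) in hw by ring.
    rewrite Cmod_0 in hw. unfold s in hw. lra. }
  specialize (Ha (z + RtoC s)%C ltac:(rewrite hw; unfold s; lra)).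
  specialize (Hb (z + RtoC s)%C ltac:(rewrite hw; unfold s; lra)).
  rewrite <- (E (z + RtoC s)%C hne ltac:(rewrite hw; unfold s; lra)) in Hb.
  pose proof (Cmod_triangle_minus (f z) (f (z + RtoC s)%C) (h z)) as K.
  rewrite (Cmod_minus_sym (f z) (f _)) in K. lra.
Qed.

(** [V] vanishes at 0, so its coefficients can be shifted by one. The shifted series equals [T] off
    0, and continuity of both sides settles the point 0. *)
Lemma analytic_at_0_div (V T : C -> C) : analytic_at V 0%C ->
  @continuous C_UniformSpace C_UniformSpace T (RtoC 0) ->
  (forall z, V z = z * T z)%C -> analytic_at T 0%C.
Proof.
  intros [a [r Hr]] CT E.
  assert (Hser : forall w, Cmod w < r ->
    lim_C (fun n => psum (fun k => a k * w ^ k)%C n) (V w)).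
  { intros w hw. apply is_pseries_lim_C. specialize (Hr w).
    replace (w - 0)%C with w in Hr by ring. auto. }
  assert (hshift : forall w n, psum (fun k => a k * w ^ k)%C (S n) =
     (a O + w * psum (fun k => a (S k) * w ^ k) n)%C).
  { intros w n. rewrite psum_S_l, (Cmult_comm w), psum_mult_r. f_equal; [simpl; ring|].
    apply psum_ext. intros k _. simpl. ring. }
  assert (ha0 : a O = RtoC 0).
  { pose proof (Hser 0%C) as L. rewrite Cmod_0 in L. specialize (L (cond_pos r)).
    rewrite E in L. replace (0 * T 0)%C with (RtoC 0) in L by ring.
    refine (lim_C_unique _ _ _ _ L). intros e he. exists 1%nat. intros [|n] hn; [lia|].
    rewrite hshift. replace (a O + 0 * _ - a O)%C with (RtoC 0) by ring. now rewrite Cmod_0. }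
  set (B := fun w => if Ceq_dec w 0 then a 1%nat else T w).
  assert (HB : analytic_at B 0%C).
  { exists (fun k => a (S k)), r. intros w hw. apply is_pseries_lim_C.
    replace (w - 0)%C with w in * by ring. unfold B.
    destruct (Ceq_dec w 0) as [->|hw0].
    - intros e he. exists 1%nat. intros [|n] hn; [lia|]. rewrite psum_S_l.
      rewrite (psum_ext _ (fun _ => RtoC 0)) by (intros; simpl; ring).
      rewrite psum_zero.
      simpl. replace (_ - _)%C with (RtoC 0) by ring. now rewrite Cmod_0.
    - pose proof (Hser w hw) as L. rewrite E in L. apply (lim_C_mult_l (/ w)%C) in L.
      replace (/ w * (w * T w))%C with (T w) in L by (field; exact hw0).
      intros e he. destruct (L e he) as [N HN]. exists N. intros n hn.
      specialize (HN (S n) ltac:(lia)). rewrite hshift, ha0 in HN.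
      replace (/ w * (0 + w * psum (fun k => a (S k) * w ^ k) n))%C with
        (psum (fun k => a (S k) * w ^ k) n)%C in HN by (field; exact hw0).
      exact HN. }
  assert (E0 : B 0%C = T 0%C).
  { apply (continuous_eq_punctured B T (RtoC 0) 1 Rlt_0_1); [|exact CT|].
    - apply C1_at_continuous, analytic_at_C1, HB.
    - intros w hw _. unfold B. destruct (Ceq_dec w 0); [contradiction | reflexivity]. }
  apply (analytic_at_ext_loc B T (RtoC 0) 1 Rlt_0_1); [|exact HB].
  intros w _. destruct (Ceq_dec w 0) as [->|hw]; [exact E0|].
  unfold B. destruct (Ceq_dec w 0); [contradiction | reflexivity].
Qed.

Lemma disc_algebra_Top g f : HD g -> HD f ->
  disc_algebra (Vop g f) -> disc_algebra (Top g f).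
Proof.
  intros Hg Hf [HV [F [CF EF]]].
  pose proof (Top_continuous_at_0 g f Hg Hf) as C0.
  split.
  - intros z hz. destruct (Ceq_dec z 0) as [->|hz0].
    + apply (analytic_at_0_div (Vop g f)); [now apply HV | exact C0|].
      intros; apply Vop_Top.
    + apply (analytic_at_ext_loc (fun w => / w * Vop g f w)%C _ z (Cmod z)).
      * apply Cmod_gt_0, hz0.
      * intros w hw. symmetry. apply Top_nonzero. intros ->.
        rewrite Cmod_minus_sym in hw. replace (z - 0)%C with z in hw by ring. lra.
      * apply C1_at_analytic, C1_at_mult; [now apply C1_at_inv|].
        apply analytic_at_C1, HV, hz.
  (* At nonzero points, boundary included, dividing the extension [F] by [w] is continuous; at 0,
     [G] coincides nearby with [Top g f]. *)
  - set (G := fun w => if Ceq_dec w 0 then Top g f 0%C else (/ w * F w)%C).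
    assert (EG : forall z, disc z -> G z = Top g f z).
    { intros z hz. unfold G. destruct (Ceq_dec z 0) as [->|hz0]; [reflexivity|].
      rewrite EF by exact hz. symmetry. now apply Top_nonzero. }
    exists G. split; [|exact EG].
    apply continuous_on_Cmod. intros z hz eps heps. destruct (Ceq_dec z 0) as [->|hz0].
    + destruct (proj1 (locally_Cmod _ _) (proj1 (continuous_Cmod _ _) C0 _ heps)) as [d [hd Hd]].
      exists (Rmin d 1). split; [apply Rmin_pos; lra|]. intros w _ hw.
      pose proof (Rmin_l d 1). pose proof (Rmin_r d 1).
      rewrite !EG; [apply Hd; lra | |].
      * unfold disc. rewrite Cmod_0. lra.
      * unfold disc. replace (w - 0)%C with w in hw by ring. lra.
    + assert (W : Filter (within closed_disc (@locally C_UniformSpace z)))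
        by (apply within_filter, locally_filter).
      assert (L : filterlim (fun w => / w * F w)%C (within closed_disc (@locally C_UniformSpace z))
        (@locally C_UniformSpace (/ z * F z)%C)).
      { apply filterlim_C_mult; [exact W| |apply CF, hz].
        intros P HP.
        destruct (continuous_Cinv (fun w => w) z hz0 (continuous_Cid z) P HP) as [d Hd].
        exists d. intros w hw _. now apply Hd. }
      pose proof (proj1 (filterlim_Cmod _ _ _) L eps heps) as K. unfold within in K.
      apply locally_Cmod in K. destruct K as [d [hd K]].
      assert (hcz : 0 < Cmod z) by (apply Cmod_gt_0, hz0).
      exists (Rmin d (Cmod z)). split; [now apply Rmin_pos|]. intros w hw hwz.
      pose proof (Rmin_l d (Cmod z)). pose proof (Rmin_r d (Cmod z)).
      unfold G. destruct (Ceq_dec z 0) as [X|_]; [contradiction|].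
      destruct (Ceq_dec w 0) as [->|_].
      * rewrite Cmod_minus_sym in hwz. replace (z - 0)%C with z in hwz by ring. lra.
      * apply K; [lra | exact hw].
Qed.

(** * Linear structure and conclusion *)

Lemma linear_subspace_HInf : linear_subspace HInf.
Proof.
  split; [|split].
  - split; [apply HD_const|]. exists 0. intros; rewrite Cmod_0; lra.
  - intros f h [Hf [M HM]] [Hh [K HK]]. split; [now apply HD_plus|].
    exists (M + K). intros z hz. specialize (HM z hz). specialize (HK z hz).
    eapply Rle_trans; [apply Cmod_triangle | lra].
  - intros c f [Hf [M HM]]. split; [apply HD_mult; [apply HD_const | exact Hf]|].
    exists (Cmod c * M). intros z hz. rewrite Cmod_mult.
    apply Rmult_le_compat_l; [apply Cmod_ge_0 | now apply HM].
Qed.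

(** Linearity of [Vop g] is available at points of the disc, where the integrands are continuous;
    [disc_algebra_ext] makes this enough. *)
Lemma linear_subspace_optimal_domain g : HD g ->
  linear_subspace (optimal_domain (Vop g) disc_algebra).
Proof.
  intros hg. split; [|split].
  - split; [apply HD_const|].
    apply (disc_algebra_ext (fun _ => RtoC 0)); [|apply disc_algebra_const].
    intros z hz. symmetry. now apply Vop_zero.
  - intros f h [Hf Vf] [Hh Vh]. split; [now apply HD_plus|].
    apply (disc_algebra_ext (fun z => Vop g f z + Vop g h z)%C).
    + intros z hz. symmetry. now apply Vop_plus.
    + now apply disc_algebra_plus.
  - intros c f [Hf Vf]. split; [apply HD_mult; [apply HD_const | exact Hf]|].
    apply (disc_algebra_ext (fun z => c * Vop g f z)%C).
    + intros z hz. symmetry. now apply Vop_scal.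
    + apply disc_algebra_mult; [apply disc_algebra_const | exact Vf].
Qed.

Theorem proposition3p17 (g : C -> C) (hg : HD g)
    (hV : compact_operator disc_algebra (Vop g)) :
  proper_subspace HInf (optimal_domain (Vop g) disc_algebra) /\
  (forall f : C -> C,
     optimal_domain (Vop g) disc_algebra f <->
     optimal_domain (Top g) disc_algebra f).
Proof.
  split.
  - split; [apply linear_subspace_HInf|].
    split; [now apply linear_subspace_optimal_domain|]. split.
    + intros f Hf. split; [apply Hf | now apply HInf_Vop].
    + now apply unbounded_optimal.
  - intros f. split; intros [Hf H]; split; try exact Hf.
    + now apply disc_algebra_Top.
    + apply (disc_algebra_ext (fun z => z * Top g f z)%C).
      * intros z _. symmetry. apply Vop_Top.
      * apply (disc_algebra_mult (fun z => z)); [|exact H].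
        apply (disc_algebra_ext (fun z => z ^ 1)%C); [intros; ring | apply disc_algebra_pow].
Qed.
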